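(* Let $\mathcal V=\{V;\nu_1,\dots,\nu_n\}$ be a vector arrangement over $\Bbbk$ with associated hyperplane arrangement $\mathcal H$, and let $l\in[n]$. There is a short exact sequence of tri-graded chain complexes $$0\to\mathcal C_\partial^T(\mathcal H-H_l)\xrightarrow{\ \iota\ }\mathcal C_\partial^T(\mathcal H)\xrightarrow{\ \pi\ }\mathcal C_\partial^T(\mathcal H^{H_l})[1]\to0,$$ where $[1]$ denotes a degree shift by $(1,0,0)$ in the tri-grading. Thus there is an induced long exact sequence $$\cdots\to H_\partial^{T,i}(\mathcal H-H_l)\to H_\partial^{T,i}(\mathcal H)\to H_\partial^{T,i}(\mathcal H^{H_l})[1]\to H_\partial^{T,i+1}(\mathcal H-H_l)\to\cdots$$
   Context: Let $\Bbbk$ be a field of characteristic zero. A vector arrangement $\mathcal V=\{V;\nu_1,\dots,\nu_n\}$ is a finite-dimensional $\Bbbk$-vector space $V$ with an inner product together with a list of vectors $\nu_i\in V$ (zero allowed). The associated hyperplane arrangement is $\mathcal H=\{V;H_1,\dots,H_n\}$, $H_i=\nu_i^\perp$ (so $H_i=V$ if $\nu_i=0$). For $S\subseteq[n]=\{1,\dots,n\}$ put $H_S=\bigcap_{s\in S}H_s$ ($H_\emptyset=V$), $W=\{w\in\Bbbk^n:\sum_iw_i\nu_i=0\}$ with the inner product induced from the standard one on $\Bbbk^n$, and $W_S=\{w\in W:w_r=0\text{ for }r\notin S\}$. For all arrangements involved, the inner products are understood to restrict non-degenerately to all subspaces onto which orthogonal projections are taken. Deletion: $\mathcal H-H_l$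 is the arrangement in $V$ with $H_l$ removed (associated to $\mathcal V$ with $\nu_l$ removed). Restriction: $\mathcal H^{H_l}$ is the arrangement in $H_l$ associated to the vectors $P(\nu_i)$, $i\ne l$, with $P$ the orthogonal projection onto $\nu_l^\perp=H_l$. Chain complex: $\mathcal C_\partial^T(\mathcal H)=\bigoplus_{S\subseteq[n]}\bigwedge^\bullet H_S\otimes\bigwedge^\bullet W_S$ with $\deg(\bigwedge^iH_S\otimes\bigwedge^jW_S)=(|S|+i,\,i,\,j)$ and differential $\partial^T=\bigoplus_{S,\,s\in S}w_{S,s}\otimes b_{S,s}$, where $w_{S,s}:\bigwedge^\bullet H_S\to\bigwedge^{\bullet+1}H_{S-s}$ is inclusion followed by left wedging with the orthogonal projection of $\nu_s$ to $H_{S-s}$, and $b_{S,s}:\bigwedge^\bullet W_S\to\bigwedge^\bullet W_{S-s}$ is induced by orthogonal projection. The differential has degree $(0,1,0)$; the second degree is homological and $H_\partial^{T,i}(\mathcal H)$ is the homology in second degree $i$.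
   Formalization: The formal theorem assumes ν_l ≠ 0; for ν_l = 0 the restriction equals the deletion and the total dimension of the complex of H is three times that of H−H_l, so the short exact sequence cannot exist (e.g. V=0, n=1, ν_1=0). *)

(* Defs.v *)
From HB Require Import structures.
From mathcomp Require Import all_boot all_order all_algebra.
From mathcomp Require Import sesquilinear.

Set Implicit Arguments.
Unset Strict Implicit.
Unset Printing Implicit Defensive.

Import GRing.Theory.
Local Open Scope ring_scope.

Section Forms.
Variables (K : fieldType) (V : vectType K) (B : {symmetric V}).

Definition nondeg (U : {vspace V}) : bool := (U :&: orthov B U == 0)%VS.

(* When [nondeg U] holds, V is the direct sum of U and its orthogonal, and this
   is the orthogonal projection of V onto U; it is only used for such U. *)
Definition oproj (U : {vspace V}) : 'End(V) := daddv_pi U (orthov B U).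

Lemma oproj_in U v : oproj U v \in U.
Proof. exact: memv_pi. Qed.

Lemma oproj_id U u : nondeg U -> u \in U -> oproj U u = u.
Proof. by move/eqP => U0 uU; rewrite /oproj daddv_pi_id. Qed.
End Forms.

Section StandardForm.
Variables (K : fieldType) (n : nat).

Definition dotr (u v : 'rV[K]_n) : K := \sum_i u 0 i * v 0 i.

Fact dotr_bilinear :
  bilinear_for (GRing.Scale.Law.clone _ _ *%R _)
               (GRing.Scale.Law.clone _ _ (idfun \; *%R) _) dotr.
Proof.
split=> [u|u] a v w; rewrite /dotr /= mulr_sumr -big_split.
  by apply: eq_bigr => i _; rewrite !mxE mulrDl mulrA.
by apply: eq_bigr => i _; rewrite !mxE mulrDr mulrCA.
Qed.
HB.instance Definition _ := bilinear_isBilinear.Build K _ _ _ _ _ dotr dotr_bilinear.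

Fact dotr_symmetric u v : dotr u v = (-1) ^+ false * idfun (dotr v u).
Proof. by rewrite mul1r; apply: eq_bigr => i _; rewrite mulrC. Qed.
HB.instance Definition _ :=
  isHermitianSesquilinear.Build K _ false idfun dotr dotr_symmetric.

End StandardForm.

(* The exterior algebra of V.  With m = dim V and b_0, ..., b_(m-1) the basis
   [vbasis fullv], the function x : {set 'I_m} -> K stands for
   \sum_A x A . b_A, where b_A is the wedge product of the b_a (a \in A)
   in increasing order. *)
Notation Ext K V := {ffun {set 'I_(\dim {: V})} -> K^o}.

Section Exterior.
Variables (K : fieldType) (V : vectType K).

Definition ext_e (A : {set 'I_(\dim {: V})}) : Ext K V :=
  [ffun A' => (A' == A)%:R].

(* x |-> v /\ x, from b_i /\ b_A = 0 if i \in A, and otherwise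
   b_i /\ b_A = (-1) ^ #{a \in A | a < i} b_(i |: A). *)
Definition wedge (v : V) (x : Ext K V) : Ext K V :=
  [ffun A : {set 'I_(\dim {: V})} => \sum_(i in A)
     (-1) ^+ #|[set a in A | (a < i)%N]| *
     coord (vbasis {: V}) i v * x (A :\ i)].

Definition wedges (s : seq V) : Ext K V := foldr wedge (ext_e set0) s.

Fact wedge_linear v : linear (wedge v).
Proof.
move=> a x y; apply/ffunP => A; rewrite !ffunE scaler_sumr -big_split.
by apply: eq_bigr => i _; rewrite !ffunE mulrDr /GRing.scale /= mulrCA.
Qed.
HB.instance Definition _ v :=
  GRing.isLinear.Build K (Ext K V) (Ext K V) _ (wedge v) (wedge_linear v).

Fact wedgel_linear x : linear (wedge^~ x).
Proof.
move=> a u v; apply/ffunP => A; rewrite !ffunE scaler_sumr -big_split.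
apply: eq_bigr => i _; rewrite linearP /= mulrDr mulrDl /GRing.scale /=.
by rewrite [_ * (a * _)]mulrCA !mulrA.
Qed.

(* The p-th exterior power of U, inside the exterior algebra of V. *)
Definition extpow (p : nat) (U : {vspace V}) : {vspace Ext K V} :=
  <<[seq wedges [seq (vbasis U)`_k | k : 'I_(\dim U) <- t]
     | t : p.-tuple 'I_(\dim U)]>>%VS.

Lemma extpow_wedges (U : {vspace V}) (s : seq V) :
  {subset s <= U} -> wedges s \in extpow (size s) U.
Proof.
elim: s => [_|v s IHs sU].
  apply: memv_span; apply/imageP; exists [tuple] => //.
have vU : v \in U by apply: sU; rewrite mem_head.
have {IHs}/IHs : {subset s <= U} by move=> w ws; apply: sU; rewrite inE ws orbT.
rewrite /= (coord_vbasis vU); move: (wedges s) => x xU.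
rewrite -[wedge _ x]/((wedge^~ x) _).
pose L : {linear V -> Ext K V} :=
  HB.pack (wedge^~ x) (GRing.isLinear.Build _ _ _ _ _ (wedgel_linear x)).
rewrite -[wedge^~ x]/(L : V -> _) linear_sum; apply: memv_suml => k _.
rewrite linearZ memvZ //= {L}.
rewrite (coord_span xU) linear_sum; apply: memv_suml => i _.
rewrite linearZ memvZ //=.
set y := _`_i; have : y \in [seq wedges [seq (vbasis U)`_k | k : 'I_(\dim U) <- t]
     | t : (size s).-tuple 'I_(\dim U)] by apply: mem_nth; rewrite size_map -cardE.
case/imageP => t _ ->; apply: memv_span; apply/imageP.
by exists [tuple of k :: t].
Qed.

End Exterior.

(* The algebra morphism induced by a linear map f. *)
Definition ext_map (K : fieldType) (V V' : vectType K) (f : 'Hom(V, V'))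
    (x : Ext K V) : Ext K V' :=
  \sum_A x A *: wedges [seq f (vbasis {: V})`_i | i : 'I_(\dim {: V}) <- enum A].

(* The tensor product of the spaces of functions I -> K and J -> K is the space
   of functions I * J -> K. *)
Section Tensor.
Variables (K : fieldType) (I J : finType).

Definition tens (x : {ffun I -> K^o}) (y : {ffun J -> K^o}) :
    {ffun I * J -> K^o} := [ffun ij => x ij.1 * y ij.2].

Definition tensv (X : {vspace {ffun I -> K^o}}) (Y : {vspace {ffun J -> K^o}}) :
    {vspace {ffun I * J -> K^o}} :=
  <<[seq tens x y | x <- vbasis X, y <- vbasis Y]>>%VS.

Definition tens_map (f : {ffun I -> K^o} -> {ffun I -> K^o})
    (g : {ffun J -> K^o} -> {ffun J -> K^o}) (t : {ffun I * J -> K^o}) :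
    {ffun I * J -> K^o} :=
  \sum_ij t ij *: tens (f [ffun i => (i == ij.1)%:R])
                       (g [ffun j => (j == ij.2)%:R]).

Fact tens_map_linear f g : linear (tens_map f g).
Proof.
move=> a t u; rewrite /tens_map scaler_sumr -big_split.
by apply: eq_bigr => ij _; rewrite !ffunE scalerDl scalerA.
Qed.
HB.instance Definition _ f g :=
  GRing.isLinear.Build K _ _ _ (tens_map f g) (tens_map_linear f g).

Lemma tens_map_tens (f : {linear {ffun I -> K^o} -> {ffun I -> K^o}})
    (g : {linear {ffun J -> K^o} -> {ffun J -> K^o}}) x y :
  tens_map f g (tens x y) = tens (f x) (g y).
Proof.
have fE (L : finType) (h : {linear {ffun L -> K^o} -> {ffun L -> K^o}}) z :
    h z = \sum_l z l *: h [ffun k => (k == l)%:R].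
  rewrite -[in LHS](_ : \sum_l z l *: [ffun k => (k == l)%:R] = z).
    by rewrite linear_sum; apply: eq_bigr => l _; rewrite linearZ.
  apply/ffunP => k; rewrite sum_ffunE (bigD1 k) //= !ffunE eqxx.
  rewrite [_ *: _]mulr1 big1 ?addr0 // => l /negPf nlk.
  by rewrite !ffunE eq_sym nlk scaler0.
apply/ffunP => -[i j]; rewrite sum_ffunE ffunE /= (fE _ f x) (fE _ g y).
rewrite !sum_ffunE big_distrlr /= pair_bigA /=; apply: eq_bigr => -[k l] _.
by rewrite !ffunE /= /GRing.scale /= mulrACA.
Qed.

End Tensor.

(* A vector arrangement in the subspace [space] of V, which carries the
   restriction of [inner]; an arrangement in all of V is the case
   [space = fullv].  Subspaces are allowed because a restriction lives in one. *)
Record arrangement (K : fieldType) (V : vectType K) (n : nat) := Arrangement {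
  inner : {symmetric V};
  space : {vspace V};
  nu : 'I_n -> V;
  nu_in : forall i, nu i \in space
}.

Section Arrangements.
Variables (K : fieldType) (V : vectType K).

Definition hyper n (A : arrangement V n) (i : 'I_n) : {vspace V} :=
  (space A :&: orthov (inner A) <[nu A i]>)%VS.

Definition flat n (A : arrangement V n) (S : {set 'I_n}) : {vspace V} :=
  (space A :&: \bigcap_(s in S) hyper A s)%VS.

Definition lin_comb n (A : arrangement V n) (w : 'rV[K]_n) : V :=
  \sum_i w 0 i *: nu A i.

Fact lin_comb_linear n (A : arrangement V n) : linear (lin_comb A).
Proof.
move=> a u v; rewrite /lin_comb scaler_sumr -big_split; apply: eq_bigr => i _.
by rewrite !mxE scalerDl scalerA.
Qed.
HB.instance Definition _ n (A : arrangement V n) :=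
  GRing.isLinear.Build K _ _ _ (lin_comb A) (lin_comb_linear A).

Definition relations n (A : arrangement V n) : {vspace 'rV[K]_n} :=
  lker (linfun (lin_comb A)).

Definition relations_on n (A : arrangement V n) (S : {set 'I_n}) :
    {vspace 'rV[K]_n} :=
  (relations A :&: \bigcap_(r | r \notin S) lker (linfun (col r)))%VS.

Lemma mem_hyper n (A : arrangement V n) i v :
  (v \in hyper A i) = (v \in space A) && (inner A v (nu A i) == 0).
Proof. by rewrite memv_cap mem_orthov1. Qed.

Lemma mem_flat n (A : arrangement V n) S v :
  v \in flat A S <->
  v \in space A /\ (forall s, s \in S -> inner A v (nu A s) = 0).
Proof.
rewrite memv_cap; split=> [/andP[vA /subv_bigcapP vS]|[vA vS]].
  split=> // s sS; apply/eqP; have := vS s sS.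
  by rewrite -memvE mem_hyper => /andP[].
rewrite vA; apply/subv_bigcapP => s sS.
by rewrite -memvE mem_hyper vA vS ?eqxx.
Qed.

Lemma mem_relations n (A : arrangement V n) (w : 'rV_n) :
  (w \in relations A) = (\sum_i w 0 i *: nu A i == 0).
Proof.
by rewrite memv_ker lfunE.
Qed.

Lemma mem_relations_on n (A : arrangement V n) S (w : 'rV_n) :
  w \in relations_on A S <->
  \sum_i w 0 i *: nu A i = 0 /\ (forall r, r \notin S -> w 0 r = 0).
Proof.
rewrite memv_cap mem_relations; split=> [/andP[/eqP wA /subv_bigcapP wS]|].
  split=> // r rS; have := wS r rS; rewrite -memvE memv_ker lfunE /=.
  by move/eqP/matrixP/(_ 0 0); rewrite !mxE.
case=> -> wS; rewrite eqxx; apply/subv_bigcapP => r rS.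
rewrite -memvE memv_ker lfunE /=; apply/eqP/matrixP => i j.
by rewrite !mxE ord1 wS.
Qed.

(* All the nondegeneracy that is understood: [inner] and the standard form are
   inner products on the space and on the space of relations, and they stay
   nondegenerate on the subspaces onto which the differential projects. *)
Definition admissible n (A : arrangement V n) : Prop :=
  [/\ nondeg (inner A) (space A),
      forall S : {set 'I_n}, S \proper setT -> nondeg (inner A) (flat A S),
      nondeg (@dotr K n) (relations A)
    & forall S : {set 'I_n}, S \proper setT ->
        nondeg (@dotr K n) (relations_on A S)].

Definition deletion n (A : arrangement V n.+1) (l : 'I_n.+1) : arrangement V n :=
  Arrangement (inner A) (fun i => nu_in A (lift l i)).

Definition restriction n (A : arrangement V n.+1) (l : 'I_n.+1) :
    arrangement V n :=
  Arrangement (inner A)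
    (fun i => oproj_in (inner A) (hyper A l) (nu A (lift l i))).

End Arrangements.

(* The components form a family indexed by the tri-degrees, of subspaces of a
   common carrier; the differential is only considered on the components. *)
Record tricomplex (K : fieldType) := Tricomplex {
  carrier :> vectType K;
  comp : int -> int -> int -> {vspace carrier};
  diff : 'End(carrier)
}.

Section Complexes.
Variable K : fieldType.
Implicit Types C D E : tricomplex K.

Definition chain_complex C : Prop :=
  (forall a i j, (diff C @: comp C a i j <= comp C a (i + 1) j)%VS) /\
  (forall a i j x, x \in comp C a i j -> diff C (diff C x) = 0).

Definition chain_map C D (f : 'Hom(C, D)) : Prop :=
  (forall a i j, (f @: comp C a i j <= comp D a i j)%VS) /\
  (forall a i j x, x \in comp C a i j -> f (diff C x) = diff D (f x)).

Definition short_exact C D E (f : 'Hom(C, D)) (g : 'Hom(D, E)) : Prop :=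
  forall a i j,
  [/\ (comp C a i j :&: lker f = 0)%VS,
      (f @: comp C a i j = comp D a i j :&: lker g)%VS
    & (g @: comp D a i j = comp E a i j)%VS].

Definition ses_of_complexes C D E (f : 'Hom(C, D)) (g : 'Hom(D, E)) : Prop :=
  [/\ chain_complex C /\ chain_complex D /\ chain_complex E,
      chain_map f, chain_map g & short_exact f g].

(* Degree shift by (1, 0, 0): an element of tri-degree (a, i, j) of C has
   tri-degree (a + 1, i, j) in [shift C]. *)
Definition shift C : tricomplex K :=
  Tricomplex (fun a i j => comp C (a - 1) i j) (diff C).

Definition cycles C a i j : {vspace C} := (comp C a i j :&: lker (diff C))%VS.
Definition boundaries C a i j : {vspace C} := (diff C @: comp C a (i - 1) j)%VS.

(* The quotient of the cycles by the boundaries, realised on a complement of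
   the boundaries in the cycles; see hclass_onto and hclass_eq0. *)
Definition homology C a i j : vectType K :=
  subvs_of (cycles C a i j :\: boundaries C a i j)%VS.

Definition hclass C a i j : 'Hom(C, homology C a i j) :=
  (linfun (vsproj (cycles C a i j :\: boundaries C a i j)%VS) \o
   addv_pi1 (cycles C a i j) (boundaries C a i j))%VF.

(* [z] |-> [f z]; see hmap_hclass. *)
Definition hmap C D (f : 'Hom(C, D)) a i j :
    'Hom(homology C a i j, homology D a i j) :=
  (hclass D a i j \o f \o
   linfun (@vsval K C (cycles C a i j :\: boundaries C a i j)%VS))%VF.

Lemma hclass_val C a i j z :
  vsval (hclass C a i j z) = addv_pi1 (cycles C a i j) (boundaries C a i j) z.
Proof. by rewrite comp_lfunE lfunE /= vsprojK // memv_pi. Qed.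

Lemma hclass_onto C a i j (h : homology C a i j) :
  exists2 z, z \in cycles C a i j & hclass C a i j z = h.
Proof.
exists (vsval h); first by rewrite (subvP (diffvSl _ _) _ (subvsP h)).
apply: val_inj; rewrite /= hclass_val.
by rewrite daddv_pi_id ?subvsP // capv_diff.
Qed.

Lemma hclass_eq0 C a i j z : z \in cycles C a i j ->
  (hclass C a i j z == 0) = (z \in boundaries C a i j).
Proof.
move=> zZ; rewrite -(inj_eq val_inj) /= hclass_val.
rewrite [X in _ == X](linear0 (@vsval K C (cycles C a i j :\: boundaries C a i j)%VS)).
have zD : z \in (cycles C a i j + boundaries C a i j)%VS.
  by rewrite (subvP (addvSl _ _)).
have zE := addv_pi1_pi2 zD.
apply/eqP/idP => [z0|zB].
  by rewrite -zE z0 add0r memv_pi2.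
apply/eqP; rewrite -memv0 -(capv_diff (cycles C a i j) (boundaries C a i j)).
rewrite memv_cap memv_pi /=.
have -> : addv_pi1 (cycles C a i j) (boundaries C a i j) z =
   z - addv_pi2 (cycles C a i j) (boundaries C a i j) z by rewrite -{2}zE addrK.
by rewrite memvB ?memv_pi2.
Qed.

Lemma chain_map_cycles C D (f : 'Hom(C, D)) a i j z : chain_map f ->
  z \in cycles C a i j -> f z \in cycles D a i j.
Proof.
case=> fC fd; rewrite !memv_cap !memv_ker => /andP[zC /eqP dz0].
by rewrite -(fd _ _ _ _ zC) dz0 linear0 eqxx (subvP (fC a i j)) ?memv_img.
Qed.

Lemma chain_map_boundaries C D (f : 'Hom(C, D)) a i j z : chain_map f ->
  z \in boundaries C a i j -> f z \in boundaries D a i j.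
Proof.
case=> fC fd /memv_imgP[x xC ->].
by rewrite (fd _ _ _ _ xC) memv_img // (subvP (fC _ _ _)) ?memv_img.
Qed.

Lemma hmap_hclass C D (f : 'Hom(C, D)) a i j z : chain_map f ->
  z \in cycles C a i j -> hmap f a i j (hclass C a i j z) = hclass D a i j (f z).
Proof.
move=> fCD zZ; set z' := vsval (hclass C a i j z).
have -> : hmap f a i j (hclass C a i j z) = hclass D a i j (f z').
  by rewrite comp_lfunE lfunE /= [linfun vsval _]lfunE.
have z'E : z' = addv_pi1 (cycles C a i j) (boundaries C a i j) z.
  exact: hclass_val.
have z'D : z' \in (cycles C a i j :\: boundaries C a i j)%VS.
  by rewrite z'E memv_pi.
have z'Z : z' \in cycles C a i j by rewrite (subvP (diffvSl _ _) _ z'D).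
have zB : z - z' \in boundaries C a i j.
  rewrite -hclass_eq0 ?memvB // linearB /= subr_eq0; apply/eqP/val_inj => /=.
  by rewrite [RHS]hclass_val daddv_pi_id // capv_diff.
apply/eqP; rewrite eq_sym -subr_eq0 -!linearB /=.
rewrite hclass_eq0; first exact: chain_map_boundaries.
by apply: (chain_map_cycles fCD); rewrite memvB.
Qed.

Definition connecting C D E (f : 'Hom(C, D)) (g : 'Hom(D, E))
    (delta : forall a i j, 'Hom(homology E a i j, homology C a (i + 1) j)) :
    Prop :=
  forall a i j x y,
  x \in comp D a i j -> y \in comp C a (i + 1) j ->
  g x \in cycles E a i j -> f y = diff D x ->
  delta a i j (hclass E a i j (g x)) = hclass C a (i + 1) j y.

Definition long_exact C D E (f : 'Hom(C, D)) (g : 'Hom(D, E))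
    (delta : forall a i j, 'Hom(homology E a i j, homology C a (i + 1) j)) :
    Prop :=
  forall a i j,
  [/\ limg (hmap f a i j) = lker (hmap g a i j),
      limg (hmap g a i j) = lker (delta a i j)
    & limg (delta a i j) = lker (hmap f a (i + 1) j)].

End Complexes.

Section TComplex.
Variables (K : fieldType) (V : vectType K) (n : nat) (A : arrangement V n).

Notation TExt := {ffun {set 'I_(\dim {: V})} * {set 'I_(\dim {: 'rV[K]_n})} -> K^o}.

Definition summand (S : {set 'I_n}) (t : TExt) : {ffun {set 'I_n} -> TExt} :=
  [ffun S' => if S' == S then t else 0].

Fact summand_linear S : linear (summand S).
Proof.
move=> a t u; apply/ffunP => S'; rewrite !ffunE.
by case: (S' == S); rewrite ?scaler0 ?addr0.
Qed.
HB.instance Definition _ S :=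
  GRing.isLinear.Build K _ _ _ (summand S) (summand_linear S).

Definition T_comp (a i j : int) : {vspace {ffun {set 'I_n} -> TExt}} :=
  match i, j with
  | Posz p, Posz q =>
      (\sum_(S : {set 'I_n} | (#|S| + p)%N%:Z == a)
        linfun (summand S) @:
          tensv (extpow p (flat A S)) (extpow q (relations_on A S)))%VS
  | _, _ => 0%VS
  end.

Definition wT (S : {set 'I_n}) (s : 'I_n) : Ext K V -> Ext K V :=
  wedge (oproj (inner A) (flat A (S :\ s)) (nu A s)).

Definition bT (S : {set 'I_n}) (s : 'I_n) : Ext K 'rV[K]_n -> Ext K 'rV[K]_n :=
  ext_map (oproj (@dotr K n) (relations_on A (S :\ s))).

Definition T_diff_fun (x : {ffun {set 'I_n} -> TExt}) :
    {ffun {set 'I_n} -> TExt} :=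
  \sum_(S : {set 'I_n}) \sum_(s in S)
    summand (S :\ s) (tens_map (wT S s) (bT S s) (x S)).

Fact T_diff_linear : linear T_diff_fun.
Proof.
move=> a x y; rewrite /T_diff_fun scaler_sumr -big_split; apply: eq_bigr => S _.
rewrite scaler_sumr -big_split; apply: eq_bigr => s _.
by rewrite !ffunE !linearP.
Qed.
HB.instance Definition _ :=
  GRing.isLinear.Build K _ _ _ T_diff_fun T_diff_linear.

Definition CT : tricomplex K := Tricomplex T_comp (linfun T_diff_fun).

End TComplex.

(* Main.v *)
Require Import Defs.
From HB Require Import structures.
From mathcomp Require Import all_boot all_order all_algebra.
From mathcomp Require Import sesquilinear.
(* [comp] denotes the components of a complex, not composition of functions. *)
Import Defs.

(** The complex splits along the subsets [T] of the index set.  The differential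
    removes elements from [T], so the summands with [l \notin T] form a
    subcomplex, and the summands with [l \in T] form the quotient.

    Writing [T] as [lift l @: S] or as [l |: lift l @: S], the flats on both sides
    agree: a vector of the hyperplane [H] of [nu l] has the same inner product
    with [nu i] as with the projection of [nu i] to [H].  On the relations, the
    subcomplex is matched by inserting a zero coordinate, which is an isometry
    and hence compatible with all projections ([row_insert_oproj]).

    The quotient is more delicate.  Since [nu l] is not isotropic
    ([inner_nu_neq0]), forgetting the coordinate at [l] is a bijection from the
    relations on [l |: S] to the relations of the restriction on [S].  It is not
    an isometry, and need not commute with orthogonal projections.  But it
    commutes with the inclusions between spaces of relations, and the
    projections are adjoint to these; so the adjoint of its inverse commutes with
    the projections ([res_map], [res_map_oproj]), and it is this map that defines
    the projection of the short exact sequence.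

    The square of the differential vanishes because the two orders of removing
    two elements cancel ([T_step_anticomm]): on the relations, projecting in two
    steps is projecting at once; on the flats, the vector wedged first may be
    projected directly to the final flat, since this changes it by a multiple of
    the vector wedged second ([wedge_oproj_section]).  That all these maps act on exterior powers as
    expected rests on the functoriality of the exterior algebra ([ext_map_wedge],
    [ext_map_comp]).  The long exact sequence is the snake lemma, with linear
    choices of preimages ([snake_map]). *)

Set Implicit Arguments.
Unset Strict Implicit.
Unset Printing Implicit Defensive.
Import GRing.Theory.
Local Open Scope ring_scope.

(** * Long exact sequences *)

Section LongExact.
Variable K : fieldType.

(** A linear choice of preimages in [U] under [g], meaningful on [g @: U]: it
    makes the connecting map linear by construction. *)
Definition section_on (D E : vectType K) (g : 'Hom(D, E)) (U : {vspace D}) :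
    'Hom(E, D) :=
  (projv U \o (g \o projv U)^-1)%VF.

Lemma section_onP (D E : vectType K) (g : 'Hom(D, E)) (U : {vspace D}) e :
  e \in (g @: U)%VS -> section_on g U e \in U /\ g (section_on g U e) = e.
Proof.
move=> /memv_imgP[u uU eE].
have eh : e \in limg (g \o projv U)%VF.
  by rewrite eE -(projv_id uU) -comp_lfunE memv_img ?memvf.
rewrite [section_on g U e]comp_lfunE memv_proj; split=> //.
by rewrite -[g _]comp_lfunE limg_lfunVK.
Qed.

Section Cycles.
Variable C : tricomplex K.
Hypothesis cC : chain_complex C.

Lemma cyclesP a i j x :
  reflect (x \in comp C a i j /\ diff C x = 0) (x \in cycles C a i j).
Proof. by rewrite memv_cap memv_ker; apply: (iffP andP) => -[? /eqP]. Qed.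

Lemma comp_diff a i j x : x \in comp C a i j -> diff C x \in comp C a (i + 1) j.
Proof. by move=> xC; apply: (subvP (cC.1 a i j)); rewrite memv_img. Qed.

Lemma boundariesP a i j x :
  reflect (exists2 y, y \in comp C a i j & x = diff C y)
          (x \in boundaries C a (i + 1) j).
Proof. by rewrite /boundaries addrK; apply: memv_imgP. Qed.

Lemma hclass_eq a i j x y : x \in cycles C a i j -> y \in cycles C a i j ->
  hclass C a i j x = hclass C a i j y <-> x - y \in boundaries C a i j.
Proof.
move=> xZ yZ; rewrite -hclass_eq0 ?memvB // linearB subr_eq0.
by split=> [xy|/eqP//]; apply/eqP.
Qed.

End Cycles.

Section Snake.
Variables (C D E : tricomplex K) (f : 'Hom(C, D)) (g : 'Hom(D, E)).
Hypothesis fg : ses_of_complexes f g.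

Let cC : chain_complex C. Proof. by case: fg => -[? []]. Qed.
Let cD : chain_complex D. Proof. by case: fg => -[? []]. Qed.
Let mf : chain_map f. Proof. by case: fg. Qed.
Let mg : chain_map g. Proof. by case: fg. Qed.

Let f_inj a i j x : x \in comp C a i j -> f x = 0 -> x = 0.
Proof.
case: fg => _ _ _ /(_ a i j)[f0 _ _] xC fx0; apply/eqP; rewrite -memv0 -f0.
by rewrite memv_cap xC memv_ker fx0 eqxx.
Qed.

Let g_ker a i j x : x \in comp D a i j -> g x = 0 ->
  exists2 y, y \in comp C a i j & x = f y.
Proof.
case: fg => _ _ _ /(_ a i j)[_ fI _] xD gx0; apply/memv_imgP; rewrite fI.
by rewrite memv_cap xD memv_ker gx0 eqxx.
Qed.

Let gf0 a i j x : x \in comp C a i j -> g (f x) = 0.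
Proof.
case: fg => _ _ _ /(_ a i j)[_ fI _] xC; apply/eqP.
by rewrite -memv_ker; have := memv_img f xC; rewrite fI memv_cap => /andP[].
Qed.

Let g_surj a i j z : z \in comp E a i j ->
  exists2 x, x \in comp D a i j & z = g x.
Proof. by case: fg => _ _ _ /(_ a i j)[_ _ <-] /memv_imgP. Qed.

Let f_comp a i j x : x \in comp C a i j -> f x \in comp D a i j.
Proof. by move=> xC; apply: (subvP (mf.1 a i j)); rewrite memv_img. Qed.

Let g_comp a i j x : x \in comp D a i j -> g x \in comp E a i j.
Proof. by move=> xC; apply: (subvP (mg.1 a i j)); rewrite memv_img. Qed.

(** The class of [y] depends only on the class of [g x]: two lifts of
    homologous cycles differ by a boundary of [D] and an element of [C]. *)
Lemma connecting_unique a i j x y x' y' :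
  x \in comp D a i j -> y \in comp C a (i + 1) j -> f y = diff D x ->
  x' \in comp D a i j -> y' \in comp C a (i + 1) j -> f y' = diff D x' ->
  g x - g x' \in boundaries E a i j ->
  y - y' \in boundaries C a (i + 1) j.
Proof.
move=> xD yC fy x'D y'C fy'; rewrite -[i](subrK 1).
case/boundariesP => z /g_surj[w wD ->]; rewrite -(mg.2 _ _ _ _ wD).
have dwD := comp_diff cD wD; move/eqP.
rewrite subrK in dwD *; rewrite -linearB -subr_eq0 -linearB => /eqP gw.
have [|u uC uE] := @g_ker a i j _ _ gw; first by rewrite !memvB.
 apply/boundariesP; exists u => //.
apply/eqP; rewrite -subr_eq0; apply/eqP.
apply: (@f_inj a (i + 1) j); first by rewrite !memvB ?(comp_diff cC).
have fdu : f (diff C u) = diff D x - diff D x'.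
  rewrite (mf.2 _ _ _ _ uC) -uE linearB /= (cD.2 _ _ _ _ wD) subr0.
  exact: linearB.
by rewrite linearB /= fdu linearB /= fy fy' subrr.
Qed.

Lemma connecting_lift a i j x : x \in comp D a i j -> g x \in cycles E a i j ->
  exists2 y, y \in cycles C a (i + 1) j & f y = diff D x.
Proof.
move=> xD /cyclesP[_ dg0]; have [|y yC fy] := g_ker (comp_diff cD xD).
  by rewrite (mg.2 _ _ _ _ xD).
exists y => //; apply/cyclesP; split=> //.
apply: (f_inj (comp_diff cC yC)).
by rewrite (mf.2 _ _ _ _ yC) -fy (cD.2 _ _ _ _ xD).
Qed.

Let f_injD a i j x y : x \in comp C a i j -> y \in comp C a i j ->
  f x = f y -> x = y.
Proof.
move=> xC yC fxy; apply/eqP; rewrite -subr_eq0; apply/eqP.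
by apply: (f_inj (memvB xC yC)); rewrite linearB /= fxy subrr.
Qed.

(** The usual recipe (represent the class by a cycle, lift it along [g], apply
    the differential, pull back along [f]), each choice being made linearly. *)
Definition snake_map a i j : 'Hom(homology E a i j, homology C a (i + 1) j) :=
  (hclass C a (i + 1) j \o section_on f (comp C a (i + 1) j) \o diff D \o
   section_on g (comp D a i j) \o
   linfun (@vsval K E (cycles E a i j :\: boundaries E a i j)%VS))%VF.

Lemma snake_mapP : connecting f g snake_map.
Proof.
move=> a i j x y xD yC gxZ fy; set z := vsval (hclass E a i j (g x)).
set s := section_on g (comp D a i j) z.
set t := section_on f (comp C a (i + 1) j) (diff D s).
rewrite [LHS](_ : _ = hclass C a (i + 1) j t); last first.
  by do 4!rewrite [LHS]comp_lfunE; rewrite [linfun vsval _]lfunE.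
have zZ : z \in cycles E a i j by rewrite (subvP (diffvSl _ _) _ (subvsP _)).
have zB : z - g x \in boundaries E a i j.
  apply/(hclass_eq zZ gxZ); apply: val_inj.
  by rewrite /= hclass_val daddv_pi_id ?subvsP // capv_diff.
have [sD gs] : s \in comp D a i j /\ g s = z.
  apply: section_onP; case: fg => _ _ _ /(_ a i j)[_ _ ->].
  by case/cyclesP: zZ.
have [|u uZ fu] := @connecting_lift a i j s sD; first by rewrite gs.
have uC : u \in comp C a (i + 1) j by case/cyclesP: uZ.
have [tC ft] : t \in comp C a (i + 1) j /\ f t = diff D s.
  by apply: section_onP; rewrite -fu memv_img.
have [w wZ fw] := connecting_lift xD gxZ.
have -> : t = u by apply: (f_injD tC uC); rewrite ft fu.
have yE : y = w by case/cyclesP: (wZ) => wC _; apply: (f_injD yC wC); rewrite fy.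
rewrite yE in yC fy *; apply/(hclass_eq uZ wZ).
by apply: (connecting_unique sD uC fu xD yC fy); rewrite gs.
Qed.

Lemma snake_long_exact : long_exact f g snake_map.
Proof.
have mfZ a i j z := @chain_map_cycles K C D f a i j z mf.
have mgZ a i j z := @chain_map_cycles K D E g a i j z mg.
move=> a i j; split; apply/vspaceP => h; rewrite memv_ker; apply/idP/idP.
- case/memv_imgP=> h0 _ ->; have [z zZ <-] := hclass_onto h0.
  have /cyclesP[zC _] := zZ.
  by rewrite (hmap_hclass mf zZ) (hmap_hclass mg (mfZ _ _ _ _ zZ)) (gf0 zC) linear0.
- have [z zZ <-] := hclass_onto h; have /cyclesP[zD dz0] := zZ.
  rewrite (hmap_hclass mg zZ) hclass_eq0 ?mgZ // => /memv_imgP[_ /g_surj[w wD ->]].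
  rewrite -(mg.2 _ _ _ _ wD) => /eqP; rewrite -subr_eq0 -linearB => /eqP gzw.
  have dwB : diff D w \in boundaries D a i j by rewrite memv_img.
  have dwD := comp_diff cD wD; rewrite subrK in dwD.
  have [u uC uE] := g_ker (memvB zD dwD) gzw.
  have uZ : u \in cycles C a i j.
    apply/cyclesP; split=> //; apply: (f_inj (comp_diff cC uC)).
    by rewrite (mf.2 _ _ _ _ uC) -uE linearB /= dz0 (cD.2 _ _ _ _ wD) subr0.
  have -> : hclass D a i j z = hmap f a i j (hclass C a i j u).
    rewrite (hmap_hclass mf uZ); apply/(hclass_eq zZ (mfZ _ _ _ _ uZ)).
    by rewrite -uE subKr.
  by rewrite memv_img ?memvf.
- case/memv_imgP=> h0 _ ->; have [z zZ <-] := hclass_onto h0.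
  have /cyclesP[zD dz0] := zZ; rewrite (hmap_hclass mg zZ).
  rewrite (snake_mapP zD (mem0v _) (mgZ _ _ _ _ zZ)) ?linear0 //.
- have [e eZ <-] := hclass_onto h.
  have /cyclesP[/g_surj[x xD eE] _] := eZ; rewrite eE in eZ *.
  have [y yZ fy] := connecting_lift xD eZ; have /cyclesP[yC _] := yZ.
  rewrite (snake_mapP xD yC eZ fy) hclass_eq0 //.
  case/boundariesP => u uC yE; pose z := x - f u.
  have zZ : z \in cycles D a i j.
    apply/cyclesP; rewrite memvB ?f_comp //; split=> //.
    by rewrite linearB /= -fy yE (mf.2 _ _ _ _ uC) subrr.
  have -> : g x = g z by rewrite linearB /= (gf0 uC) subr0.
  by rewrite -(hmap_hclass mg zZ) memv_img ?memvf.
- case/memv_imgP=> h0 _ ->; have [e eZ <-] := hclass_onto h0.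
  have /cyclesP[/g_surj[x xD eE] _] := eZ; rewrite eE in eZ *.
  have [y yZ fy] := connecting_lift xD eZ; have /cyclesP[yC _] := yZ.
  rewrite (snake_mapP xD yC eZ fy) (hmap_hclass mf yZ) hclass_eq0 ?mfZ //.
  by apply/boundariesP; exists x.
- have [y yZ <-] := hclass_onto h; have /cyclesP[yC _] := yZ.
  rewrite (hmap_hclass mf yZ) hclass_eq0 ?mfZ // => /boundariesP[x xD fy].
  have gxZ : g x \in cycles E a i j.
    by apply/cyclesP; rewrite g_comp // -(mg.2 _ _ _ _ xD) -fy (gf0 yC).
  by rewrite -(snake_mapP xD yC gxZ fy) memv_img ?memvf.
Qed.

End Snake.
End LongExact.

(** * The exterior algebra *)

Lemma sum_antisym (M : zmodType) n (F : 'I_n -> 'I_n -> M) :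
  (forall i, F i i = 0) -> (forall i j, F j i = - F i j) ->
  \sum_i \sum_j F i j = 0.
Proof.
move=> F0 FN.
have FE i : \sum_j F i j = \sum_(j < n | (i < j)%N) F i j -
    \sum_(j < n | (j < i)%N) F j i.
  rewrite (bigID (fun j : 'I_n => (i < j)%N)) /=.
  rewrite [X in _ + X](bigD1 i) ?ltnn //= F0 add0r.
  congr (_ + _); rewrite -sumrN; apply: eq_big => [j|j _]; last exact: FN.
  by rewrite -leqNgt [RHS]ltn_neqAle andbC.
rewrite (eq_bigr _ (fun i _ => FE i)) big_split /= sumrN.
by rewrite (exchange_big_dep predT) //= subrr.
Qed.

Lemma linear_span_sub (K : fieldType) (aT rT : vectType K)
    (f : {linear aT -> rT}) X (Y : {vspace rT}) :
  {in X, forall x, f x \in Y} -> {in <<X>>%VS, forall x, f x \in Y}.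
Proof.
move=> fY x xX; rewrite -(lfunE f); apply: (subvP (_ : linfun f @: <<X>> <= Y)%VS).
  rewrite limg_span; apply/span_subvP => _ /mapP[y yX ->].
  by rewrite lfunE fY.
exact: memv_img.
Qed.

Lemma linear_span_eq (K : fieldType) (aT rT : vectType K)
    (f g : {linear aT -> rT}) X :
  {in X, f =1 g} -> {in <<X>>%VS, f =1 g}.
Proof.
move=> fg x xX; rewrite -(lfunE f) -(lfunE g); move: x xX.
by apply/span_lfunP => y yX; rewrite !lfunE; apply: fg.
Qed.

Lemma enum_ord_split n (i : 'I_n) : exists s1 s2,
  [/\ enum 'I_n = s1 ++ i :: s2, {in s1, forall k : 'I_n, (k < i)%N}
    & {in s2, forall k : 'I_n, (i < k)%N}].
Proof.
have si : (i < size (enum 'I_n))%N by rewrite size_enum_ord.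
exists (take i (enum 'I_n)), (drop i.+1 (enum 'I_n)); split.
- by rewrite -{2}(nth_ord_enum i i) -drop_nth // cat_take_drop.
- move=> k /(map_f val); rewrite map_take val_enum_ord take_iota mem_iota.
  by rewrite leq_min => /and3P[].
- move=> k /(map_f val); rewrite map_drop val_enum_ord drop_iota mem_iota.
  by case/andP.
Qed.

(** The position at which a new element enters an increasing enumeration is the
    exponent of the sign in the definition of [wedge]. *)
Lemma enum_setU1_split n (A : {set 'I_n}) (i : 'I_n) : exists s1 s2,
  [/\ enum (i |: A) = s1 ++ i :: s2, enum (A :\ i) = s1 ++ s2
    & size s1 = #|[set a in A | (a < i)%N]|].
Proof.
have [t1 [t2 [tE t1i t2i]]] := enum_ord_split i.
have filtE (B : {set 'I_n}) : enum B = [seq k <- t1 | k \in B] ++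
    (if i \in B then [:: i] else [::]) ++ [seq k <- t2 | k \in B].
  by rewrite -cat1s in tE; rewrite {1}/enum_mem -enumT tE !filter_cat /=; case: ifP.
have t1ne k : k \in t1 -> k != i by move/t1i; rewrite neq_ltn => ->.
have t2ne k : k \in t2 -> k != i by move/t2i; rewrite neq_ltn orbC => ->.
exists [seq k <- t1 | k \in A], [seq k <- t2 | k \in A]; split.
- rewrite filtE setU11 /=; congr (_ ++ _ :: _); apply: eq_in_filter => k kt.
    by rewrite !inE (negPf (t1ne k kt)).
  by rewrite !inE (negPf (t2ne k kt)).
- rewrite filtE setD11 /=; congr (_ ++ _); apply: eq_in_filter => k kt.
    by rewrite !inE (t1ne k kt).
  by rewrite !inE (t2ne k kt).
- rewrite cardE filtE !inE ltnn andbF /= size_cat.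
  rewrite [X in (_ + size X)%N](_ : _ = [::]) ?addn0; last first.
    rewrite -(filter_pred0 t2); apply: eq_in_filter => k /t2i ik.
    by rewrite !inE ltnNge ltnW // andbF.
  congr size; apply: eq_in_filter => k /t1i ki.
  by rewrite !inE ki andbT.
Qed.

Section ExteriorFacts.
Variables (K : fieldType) (V : vectType K).
Local Notation m := (\dim {: V}).
Local Notation b := (vbasis {: V}).
Implicit Types (u v : V) (x : Ext K V) (U : {vspace V}).

Lemma wedgeDl u v x : wedge (u + v) x = wedge u x + wedge v x.
Proof. by have := wedgel_linear x 1 u v; rewrite !scale1r. Qed.

Lemma wedge0l x : wedge 0 x = 0.
Proof.
by apply/ffunP => A; rewrite !ffunE big1 // => i _; rewrite linear0 mulr0 mul0r.
Qed.

Lemma wedgeZl a v x : wedge (a *: v) x = a *: wedge v x.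
Proof. by have := wedgel_linear x a v 0; rewrite wedge0l !addr0. Qed.

Lemma wedge_sum (I : finType) (F : I -> V) x :
  wedge (\sum_i F i) x = \sum_i wedge (F i) x.
Proof.
exact: (big_morph (fun u => wedge u x) (fun u v => wedgeDl u v x) (wedge0l x)).
Qed.

(** Removing [i] and then [j] from a set, or [j] and then [i], gives terms with
    opposite signs: the smaller of the two is counted in one of them only. *)
Lemma wedge_alt v x : wedge v (wedge v x) = 0.
Proof.
apply/ffunP => A; rewrite ffunE [RHS]ffunE.
pose c i := coord b i v.
pose s (B : {set 'I_m}) (i : 'I_m) : K := (-1) ^+ #|[set a in B | (a < i)%N]|.
pose F i j := if (i \in A) && (j \in A :\ i) then
  s A i * c i * (s (A :\ i) j * c j * x (A :\ i :\ j)) else 0.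
rewrite (eq_bigr (fun i => \sum_j F i j)); last first.
  move=> i iA; rewrite ffunE big_distrr /= big_mkcond /=; apply: eq_bigr => j _.
  by rewrite /F iA.
rewrite big_mkcond /= (eq_bigr (fun i => \sum_j F i j)); last first.
  by move=> i _; case: ifP => // iA; rewrite big1 // => j _; rewrite /F iA.
apply: sum_antisym => [i|]; first by rewrite /F setD11 andbF.
have main (i j : 'I_m) : (i < j)%N -> F j i = - F i j.
  move=> ij; have ji : (j != i) by rewrite neq_ltn ij orbT.
  rewrite /F !inE ji eq_sym ji /= andbC; case: andP => [[iA jA]|]; last by rewrite oppr0.
  have -> : s (A :\ j) i = s A i.
    congr (_ ^+ _); apply: eq_card => k; rewrite !inE.
    by case: eqP => //= ->; rewrite ltnNge ltnW // andbF.
  have -> : s A j = - s (A :\ i) j.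
    rewrite /s (cardsD1 i) !inE iA ij exprS mulN1r; congr (- (_ ^+ _)).
    by apply: eq_card => k; rewrite !inE andbA.
  have -> : A :\ j :\ i = A :\ i :\ j by rewrite !setDDl setUC.
  by rewrite !mulNr; congr (- _); rewrite mulrCA.
move=> i j; case: (ltngtP i j) => [/main //|/main ->|/val_inj ->].
  by rewrite opprK.
by rewrite /F setD11 andbF oppr0.
Qed.

Lemma wedgeC u v x : wedge u (wedge v x) = - wedge v (wedge u x).
Proof.
have := wedge_alt (u + v) x; rewrite !wedgeDl !linearD /= !wedge_alt.
by rewrite add0r addr0 => /eqP; rewrite addr_eq0 => /eqP.
Qed.

Lemma wedges_cat_cons (s1 s2 : seq V) v :
  wedges (s1 ++ v :: s2) = (-1) ^+ size s1 *: wedge v (wedges (s1 ++ s2)).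
Proof.
elim: s1 => [|u s1 IHs] /=; first by rewrite scale1r.
by rewrite IHs linearZ /= wedgeC scalerN -scaleNr exprS mulN1r.
Qed.

Lemma wedge_basis (i : 'I_m) (A : {set 'I_m}) :
  wedge b`_i (ext_e A) =
    if i \in A then 0
    else (-1) ^+ #|[set a in A | (a < i)%N]| *: ext_e (i |: A).
Proof.
have coordE k : coord b k b`_i = (k == i)%:R.
  by rewrite eq_sym coord_free ?(basis_free (vbasisP _)).
apply/ffunP => B; rewrite ffunE.
rewrite (eq_bigr (fun k => if k == i then
    (-1) ^+ #|[set a in B | (a < i)%N]| * (B :\ i == A)%:R else 0)); last first.
  move=> k _; rewrite coordE ffunE; case: eqP => [->|_]; last by rewrite mulr0 mul0r.
  by rewrite mulr1.
rewrite -big_mkcondr /=.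
case: (boolP (i \in B)) => iB; last first.
  rewrite big_pred0; last by move=> k; case: eqP => [->|]; rewrite ?(negPf iB) ?andbF.
  case: ifP => iA; rewrite !ffunE //; case: eqP => [BE|_]; last by rewrite scaler0.
  by rewrite BE setU11 in iB.
rewrite (big_pred1 i) => [|k]; last by rewrite /=; case: eqP => [->|]; rewrite ?iB ?andbF.
case: ifP => iA.
  rewrite ffunE; case: eqP => [BE|_]; last by rewrite mulr0.
  by rewrite -BE setD11 in iA.
rewrite !ffunE (_ : (B == i |: A) = (B :\ i == A)); last first.
  by apply/eqP/eqP => [->|<-]; rewrite ?setU1K ?iA // setD1K.
case: eqP => [BA|_]; last by rewrite mulr0 scaler0.
rewrite /GRing.scale /= !mulr1; congr (_ ^+ _); apply: eq_card => k.
by rewrite -BA !inE; case: eqP => // ->; rewrite ltnn !andbF.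
Qed.

(** The wedge products of basis vectors span the exterior algebra. *)
Lemma linear_ext_eq (W : lmodType K) (f g : {linear Ext K V -> W}) :
  (forall A, f (ext_e A) = g (ext_e A)) -> f =1 g.
Proof.
move=> fg x; suff -> : x = \sum_A x A *: ext_e A.
  by rewrite !linear_sum; apply: eq_bigr => A _; rewrite !linearZ /= fg.
apply/ffunP => B; rewrite sum_ffunE (bigD1 B) //= !ffunE eqxx.
rewrite [_ *: _]mulr1 big1 ?addr0 // => A /negPf nAB.
by rewrite !ffunE eq_sym nAB scaler0.
Qed.

(** The spanning family in the definition of [extpow] depends on a basis of [U];
    the next two lemmas replace it by all wedges of [p] vectors of [U]. *)
Lemma extpow_sub (W : vectType K) (f : {linear Ext K V -> W}) p U (Y : {vspace W}) :
  (forall s, {subset s <= U} -> size s = p -> f (wedges s) \in Y) ->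
  {in extpow p U, forall x, f x \in Y}.
Proof.
move=> fY; apply: linear_span_sub => _ /imageP[t _ ->]; apply: fY.
  by move=> _ /mapP[k _ ->]; rewrite vbasis_mem ?memt_nth.
by rewrite size_map size_tuple.
Qed.

Lemma extpow_eq (W : vectType K) (f g : {linear Ext K V -> W}) p U :
  (forall s, {subset s <= U} -> size s = p -> f (wedges s) = g (wedges s)) ->
  {in extpow p U, f =1 g}.
Proof.
move=> fg; apply: linear_span_eq => _ /imageP[t _ ->]; apply: fg.
  by move=> _ /mapP[k _ ->]; rewrite vbasis_mem ?memt_nth.
by rewrite size_map size_tuple.
Qed.

Lemma wedge_extpow v p U U' x : (U <= U')%VS -> v \in U' -> x \in extpow p U ->
  wedge v x \in extpow p.+1 U'.
Proof.
move=> UU' vU'; move: x; apply: extpow_sub => s sU <-.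
apply: (@extpow_wedges _ _ U' (v :: s)) => u; rewrite inE => /predU1P[-> //|us].
by apply: (subvP UU'); apply: sU.
Qed.

End ExteriorFacts.

Section ExteriorMaps.
Variables (K : fieldType).

Fact ext_map_linear (V W : vectType K) (f : 'Hom(V, W)) : linear (ext_map f).
Proof.
move=> a x y; rewrite /ext_map scaler_sumr -big_split.
by apply: eq_bigr => A _; rewrite !ffunE scalerDl scalerA.
Qed.
HB.instance Definition _ V W f :=
  GRing.isLinear.Build K _ _ _ (ext_map f) (@ext_map_linear V W f).

Lemma ext_map_e (V W : vectType K) (f : 'Hom(V, W)) A :
  ext_map f (ext_e A) = wedges [seq f (vbasis {: V})`_i | i : 'I__ <- enum A].
Proof.
rewrite /ext_map (bigD1 A) //= ffunE eqxx scale1r big1 ?addr0 // => B /negPf nBA.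
by rewrite ffunE nBA scale0r.
Qed.

(** By linearity [v] is a basis vector and [x] a wedge of basis vectors; inserting
    [v] at its place in the increasing enumeration costs the same sign on both
    sides, and a repeated factor kills both. *)
Lemma ext_map_wedge (V W : vectType K) (f : 'Hom(V, W)) v x :
  ext_map f (wedge v x) = wedge (f v) (ext_map f x).
Proof.
rewrite (coord_vbasis (memvf v)) wedge_sum [LHS]linear_sum.
rewrite [X in wedge X _]linear_sum.
rewrite wedge_sum.
apply: eq_bigr => i _; rewrite wedgeZl linearZ /=.
rewrite [X in _ = wedge X _]linearZ /= wedgeZl.
congr (_ *: _).
move: x; apply: (@linear_ext_eq _ _ _ (ext_map f \o wedge _)
                                 (wedge _ \o ext_map f)) => A /=.
rewrite ext_map_e wedge_basis.
have [s1 [s2 [iAE AiE s1E]]] := enum_setU1_split A i.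
case: ifP => iA.
  rewrite linear0 (_ : A = i |: A); last by apply/esym/setUidPr; rewrite sub1set.
  by rewrite iAE map_cat /= wedges_cat_cons linearZ /= wedge_alt scaler0.
rewrite linearZ /= ext_map_e iAE map_cat /= wedges_cat_cons size_map s1E.
rewrite scalerA -expr2 sqrr_sign scale1r -map_cat -AiE.
by rewrite (setDidPl _) // disjoints_subset subsetC sub1set inE iA.
Qed.

Lemma ext_map_wedges (V W : vectType K) (f : 'Hom(V, W)) s :
  ext_map f (wedges s) = wedges (map f s).
Proof.
elim: s => [|v s IHs] /=; last by rewrite ext_map_wedge IHs.
by rewrite ext_map_e enum_set0.
Qed.

Lemma ext_map_comp (V W W' : vectType K) (g : 'Hom(W, W')) (f : 'Hom(V, W)) x :
  ext_map (g \o f)%VF x = ext_map g (ext_map f x).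
Proof.
move: x; apply: (@linear_ext_eq _ _ _ _ (ext_map g \o ext_map f)) => A /=.
rewrite !ext_map_e ext_map_wedges -map_comp.
by congr wedges; apply: eq_map => i; rewrite comp_lfunE.
Qed.

Lemma ext_map_extpow (V W : vectType K) (f : 'Hom(V, W)) p U U' x :
  (f @: U <= U')%VS -> x \in extpow p U -> ext_map f x \in extpow p U'.
Proof.
move=> fU; move: x; apply: extpow_sub => s sU <- /=.
rewrite ext_map_wedges -(size_map f); apply: extpow_wedges => _ /mapP[u us ->].
by apply: (subvP fU); rewrite memv_img ?sU.
Qed.

Lemma ext_map_id (V : vectType K) (f : 'End(V)) p (U : {vspace V}) :
  {in U, f =1 id} -> {in extpow p U, ext_map f =1 id}.
Proof.
move=> f1; apply: (@extpow_eq _ _ _ _ idfun) => s sU _ /=; rewrite ext_map_wedges.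
by congr wedges; rewrite -[RHS]map_id; apply/eq_in_map => u /sU /f1.
Qed.

End ExteriorMaps.

(** * Tensor products and orthogonal projections *)

Section TensorFacts.
Variables (K : fieldType) (I J : finType).
Local Notation KI := {ffun I -> K^o}.
Local Notation KJ := {ffun J -> K^o}.
Local Notation KIJ := {ffun I * J -> K^o}.
Implicit Types (X : {vspace KI}) (Y : {vspace KJ}).

Fact tens_linear (x : KI) : linear (tens x : KJ -> KIJ).
Proof.
move=> a y z; apply/ffunP => ij; rewrite !ffunE mulrDr.
by rewrite /GRing.scale /= mulrCA.
Qed.
HB.instance Definition _ x := GRing.isLinear.Build K KJ KIJ _ (tens x) (tens_linear x).

Fact tensl_linear (y : KJ) : linear (fun x : KI => tens x y).
Proof.
move=> a x z; apply/ffunP => ij; rewrite !ffunE mulrDl.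
by rewrite /GRing.scale /= mulrA.
Qed.
Definition tensl y x : KIJ := tens x y.
HB.instance Definition _ y := GRing.isLinear.Build K KI KIJ _ (tensl y) (tensl_linear y).

Lemma tensv_tens X Y x y : x \in X -> y \in Y -> tens x y \in tensv X Y.
Proof.
move=> xX yY; rewrite (coord_vbasis yY) linear_sum; apply: memv_suml => j _.
rewrite linearZ memvZ //= -[tens _ _]/(tensl _ x).
rewrite (coord_vbasis xX) linear_sum; apply: memv_suml => i _.
rewrite linearZ memvZ //= /tensl.
by apply: memv_span; apply: allpairs_f; rewrite mem_nth ?size_tuple.
Qed.

Lemma tensv_sub (W : vectType K) (f : {linear KIJ -> W}) X Y (Z : {vspace W}) :
  (forall x y, x \in X -> y \in Y -> f (tens x y) \in Z) ->
  {in tensv X Y, forall t, f t \in Z}.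
Proof.
move=> fZ; apply: linear_span_sub => _ /allpairsP[[x y] /= [xX yY ->]].
by rewrite fZ ?vbasis_mem.
Qed.

Lemma tensv_eq (W : vectType K) (f g : {linear KIJ -> W}) X Y :
  (forall x y, x \in X -> y \in Y -> f (tens x y) = g (tens x y)) ->
  {in tensv X Y, f =1 g}.
Proof.
move=> fg; apply: linear_span_eq => _ /allpairsP[[x y] /= [xX yY ->]].
by rewrite fg ?vbasis_mem.
Qed.

End TensorFacts.

Section TensorMap.
Variables (K : fieldType) (I J J' : finType).

(** The tensor product of the identity with [g]: for a fixed first index, [g] is
    applied to the function of the second one. *)
Definition tens_mapr (g : {ffun J -> K^o} -> {ffun J' -> K^o})
    (t : {ffun I * J -> K^o}) : {ffun I * J' -> K^o} :=
  [ffun ij => g [ffun j => t (ij.1, j)] ij.2].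

Variable g : {linear {ffun J -> K^o} -> {ffun J' -> K^o}}.

Fact tens_mapr_linear : linear (tens_mapr g).
Proof.
move=> a t u; apply/ffunP => -[i j]; rewrite !ffunE /=.
rewrite [X in g X](_ : _ = a *: [ffun j => t (i, j)] + [ffun j => u (i, j)]).
  by rewrite linearP !ffunE.
by apply/ffunP => k; rewrite !ffunE.
Qed.
HB.instance Definition _ :=
  GRing.isLinear.Build K _ _ _ (tens_mapr g) tens_mapr_linear.

Lemma tens_mapr_tens (x : {ffun I -> K^o}) y :
  tens_mapr g (tens x y) = tens x (g y).
Proof.
apply/ffunP => -[i j]; rewrite !ffunE /=.
rewrite [X in g X](_ : _ = x i *: y) ?linearZ ?ffunE //.
by apply/ffunP => k; rewrite !ffunE.
Qed.

End TensorMap.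

Section Projections.
Variables (K : fieldType) (V : vectType K) (B : {symmetric V}).
Implicit Types (U : {vspace V}) (u v w : V).

Lemma form_sym u v : B u v = B v u.
Proof. by rewrite hermC /= expr0 mul1r. Qed.

Lemma nondeg_eq0 U u :
  nondeg B U -> u \in U -> {in U, forall v, B u v = 0} -> u = 0.
Proof.
move/eqP => U0 uU u0; apply/eqP; rewrite -memv0 -U0 memv_cap uU.
exact/mem_orthovP.
Qed.

Lemma nondeg_eq U u v : nondeg B U -> u \in U -> v \in U ->
  {in U, forall w, B u w = B v w} -> u = v.
Proof.
move=> ndU uU vU uv; apply/eqP; rewrite -subr_eq0; apply/eqP.
apply: (nondeg_eq0 ndU (memvB uU vU)) => w wU.
by rewrite linearBl /= uv // subrr.
Qed.

(** The orthogonal of [U] is the kernel of a map to a space of dimension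
    [\dim U], so a dimension count suffices; the form may be degenerate on [V]. *)
Lemma nondeg_add U : nondeg B U -> (U + orthov B U)%VS = fullv.
Proof.
move/eqP => U0; apply/eqP; rewrite eqEdim subvf /= dimv_disjoint_sum //.
pose h v : 'rV[K]_(\dim U) := \row_i B v (vbasis U)`_i.
have h_lin : linear h.
  by move=> a u v; apply/rowP => i; rewrite !mxE linearPl.
pose L : {linear V -> 'rV[K]_(\dim U)} :=
  HB.pack h (GRing.isLinear.Build _ _ _ _ _ h_lin).
have LU : (lker (linfun L) <= orthov B U)%VS.
  apply/subvP => v; rewrite memv_ker lfunE /= => /eqP/rowP hv.
  apply/mem_orthovP => u uU; rewrite (coord_vbasis uU) linear_sumr big1 //= => i _.
  by rewrite linearZr /=; have := hv i; rewrite !mxE => ->; rewrite mulr0.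
have := limg_ker_dim (linfun L) fullv; rewrite capfv => <-.
rewrite addnC leq_add ?dimvS //.
apply: leq_trans (dimvS (subvf _)) _; rewrite dimvf dim_matrix.
by rewrite mul1r.
Qed.

Lemma oproj_form U u v : nondeg B U -> u \in U -> B (oproj B U v) u = B v u.
Proof.
move=> ndU uU; have vD : v \in (U + orthov B U)%VS by rewrite nondeg_add ?memvf.
rewrite -{2}(daddv_pi_add (eqP ndU) vD) linearDl /=.
have /mem_orthovP -> // := memv_pi (orthov B U) U v.
by rewrite addr0.
Qed.

(** This characterization, rather than the definition of [oproj], is how all
    identities between projections are proved below. *)
Lemma oproj_eq U u v : nondeg B U -> u \in U ->
  {in U, forall w, B v w = B u w} -> oproj B U v = u.
Proof.
move=> ndU uU uv; apply: (nondeg_eq ndU (oproj_in _ _ _) uU) => w wU.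
by rewrite oproj_form ?uv.
Qed.

Lemma oproj_oproj U U' v : nondeg B U -> nondeg B U' -> (U' <= U)%VS ->
  oproj B U' (oproj B U v) = oproj B U' v.
Proof.
move=> ndU ndU' U'U; apply: oproj_eq => //; first exact: oproj_in.
by move=> w wU'; rewrite !oproj_form // (subvP U'U).
Qed.

(** Subtracting from [z] its component along [b] gives a vector of the hyperplane
    section that is orthogonal to it.  If [b] is isotropic it lies in its own
    hyperplane section and is orthogonal to it, hence vanishes; then the section
    is all of [U]. *)
Lemma perp_hyperplane_section U b z :
  nondeg B U -> nondeg B (U :&: orthov B <[b]>)%VS ->
  b \in U -> z \in U -> z \in orthov B (U :&: orthov B <[b]>)%VS ->
  z \in <[b]>%VS.
Proof.
set U' := (U :&: _)%VS => ndU ndU' bU zU /mem_orthovP zU'.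
have memU' u : (u \in U') = (u \in U) && (B u b == 0).
  by rewrite memv_cap mem_orthov1.
have bU' : {in U', forall u, B b u = 0}.
  by move=> u; rewrite memU' form_sym => /andP[_ /eqP].
have [bb0|bb] := eqVneq (B b b) 0.
  have b0 : b = 0 by apply: nondeg_eq0 ndU' _ bU'; rewrite memU' bU bb0 /=.
  suff -> : z = 0 by rewrite mem0v.
  by apply: nondeg_eq0 ndU zU _ => u uU; apply: zU'; rewrite memU' uU b0 linear0r eqxx.
suff /eqP : z - (B z b / B b b) *: b = 0.
  by rewrite subr_eq0 => /eqP ->; rewrite memvZ ?memv_line.
apply: (nondeg_eq0 ndU').
  by rewrite memU' memvB ?memvZ //= linearBl linearZl_LR /= divfK // subrr.
move=> u uU'; rewrite linearBl linearZl_LR /=.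
by rewrite (zU' u) // (bU' u) // mulr0 subr0.
Qed.

(** The projections of [w] to [U] and to its hyperplane section differ by a
    multiple of [oproj B U v], which the outer wedge kills. *)
Lemma wedge_oproj_section U v w (x : Ext K V) :
  nondeg B U -> nondeg B (U :&: orthov B <[v]>)%VS ->
  wedge (oproj B U v) (wedge (oproj B (U :&: orthov B <[v]>)%VS w) x) =
  wedge (oproj B U v) (wedge (oproj B U w) x).
Proof.
move=> ndU; set b := oproj B U v.
have -> : (U :&: orthov B <[v]> = U :&: orthov B <[b]>)%VS.
  apply/vspaceP => u; rewrite !memv_cap !mem_orthov1; case uU : (u \in U) => //=.
  by rewrite ![B u _]form_sym oproj_form.
set U' := (U :&: _)%VS => ndU'.
have /vlineP[k] : oproj B U w - oproj B U' w \in <[b]>%VS.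
  have U'U : (U' <= U)%VS by apply: capvSl.
  apply: (perp_hyperplane_section ndU ndU' (oproj_in _ _ _)).
    by rewrite memvB ?oproj_in // (subvP U'U) ?oproj_in.
  apply/mem_orthovP => u uU'.
  by rewrite linearBl /= (oproj_form _ ndU) ?(subvP U'U) // (oproj_form _ ndU') // subrr.
move/eqP; rewrite subr_eq => /eqP ->.
by rewrite wedgeDl linearD /= wedgeZl linearZ /= wedge_alt scaler0 add0r.
Qed.

End Projections.

(** * The complex of an arrangement *)

Section TComplexFacts.
Variables (K : fieldType) (V : vectType K) (n : nat) (A : arrangement V n).
Notation TExt := {ffun {set 'I_(\dim {: V})} * {set 'I_(\dim {: 'rV[K]_n})} -> K^o}.
Implicit Types (S T : {set 'I_n}) (a i j : int).

(** The part of tri-degree [(a, i, j)] of the summand of index [S]. *)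
Definition T_cell a i j S : {vspace TExt} :=
  match i, j with
  | Posz p, Posz q => if (#|S| + p)%N%:Z == a then
      tensv (extpow p (flat A S)) (extpow q (relations_on A S)) else 0%VS
  | _, _ => 0%VS
  end.

Lemma mem_T_comp a i j (x : CT A) :
  x \in comp (CT A) a i j <-> forall S, x S \in T_cell a i j S.
Proof.
have x0P : x \in 0%VS <-> forall S, x S \in (0%VS : {vspace TExt}).
  split=> [|x0]; first by rewrite memv0 => /eqP -> S; rewrite ffunE mem0v.
  rewrite memv0; apply/eqP/ffunP => S; apply/eqP.
  by have := x0 S; rewrite memv0 ffunE.
rewrite /= /T_comp /T_cell; case: i j => [p|p] [q|q] //.
split=> [/memv_sumP[y yP ->] S|xP].
  rewrite sum_ffunE; apply: memv_suml => T Ta.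
  have /memv_imgP[t tT ->] := yP T Ta; rewrite lfunE ffunE.
  by case: eqP => [->|_]; rewrite ?Ta ?mem0v.
rewrite (_ : x = \sum_(S : {set 'I_n} | (#|S| + p)%N%:Z == a) summand S (x S)).
  apply: memv_sumr => S Sa; have := xP S; rewrite Sa => xS.
  have -> : summand S (x S) = linfun (summand S) (x S) by rewrite lfunE.
  exact: memv_img.
apply/ffunP => T; rewrite sum_ffunE.
case: (boolP ((#|T| + p)%N%:Z == a)) => Ta.
  rewrite (bigD1 T) //= ffunE eqxx big1 ?addr0 // => S /andP[_ /negPf nST].
  by rewrite ffunE eq_sym nST.
have := xP T; rewrite (negPf Ta) memv0 => /eqP ->; rewrite big1 // => S Sa.
by rewrite ffunE; case: eqP => // ST; rewrite ST Sa in Ta.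
Qed.

Lemma T_cell_sub (W : vectType K) (f : {linear TExt -> W}) a i j S (Z : {vspace W}) :
  (forall p q x y, i = Posz p -> j = Posz q -> (#|S| + p)%N%:Z = a ->
     x \in extpow p (flat A S) -> y \in extpow q (relations_on A S) ->
     f (tens x y) \in Z) ->
  {in T_cell a i j S, forall t, f t \in Z}.
Proof.
rewrite /T_cell; case: i j => [p|p] [q|q] fZ t; try by
  rewrite memv0 => /eqP ->; rewrite linear0 mem0v.
case: eqP => [Sa|_]; last by rewrite memv0 => /eqP ->; rewrite linear0 mem0v.
by apply: tensv_sub t => x y xS yS; apply: fZ xS yS.
Qed.

Lemma T_cell_eq (W : vectType K) (f g : {linear TExt -> W}) a i j S :
  (forall p q x y, x \in extpow p (flat A S) -> y \in extpow q (relations_on A S) ->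
     f (tens x y) = g (tens x y)) ->
  {in T_cell a i j S, f =1 g}.
Proof.
rewrite /T_cell; case: i j => [p|p] [q|q] fg t; try by
  rewrite memv0 => /eqP ->; rewrite !linear0.
case: eqP => [Sa|_]; last by rewrite memv0 => /eqP ->; rewrite !linear0.
by apply: tensv_eq t => x y; apply: fg.
Qed.

(** The component of the differential from the summand of [s |: S] to that
    of [S]. *)
Definition T_step S s : TExt -> TExt :=
  tens_map (wedge (oproj (inner A) (flat A S) (nu A s)))
           (ext_map (oproj (@dotr K n) (relations_on A S))).
HB.instance Definition _ S s := GRing.Linear.on (T_step S s).

Lemma T_stepE S s x y : T_step S s (tens x y) =
  tens (wedge (oproj (inner A) (flat A S) (nu A s)) x)
       (ext_map (oproj (@dotr K n) (relations_on A S)) y).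
Proof. exact: tens_map_tens. Qed.

(** Sorting the terms by target rather than by source makes the differential
    computable one summand at a time. *)
Lemma T_diffE (x : CT A) S :
  diff (CT A) x S = \sum_(s | s \notin S) T_step S s (x (s |: S)).
Proof.
rewrite lfunE /= /T_diff_fun sum_ffunE.
rewrite (eq_bigr (fun T : {set 'I_n} => \sum_(s < n) if s \in T then
    summand (T :\ s) (tens_map (wT A T s) (bT A T s) (x T)) S else 0)); last first.
  by move=> T _; rewrite sum_ffunE big_mkcond.
rewrite exchange_big [RHS]big_mkcond /=; apply: eq_bigr => s _.
case: ifP => sS; last first.
  rewrite big1 // => T _; case: ifP => // sT; rewrite ffunE.
  by case: eqP => // ST; rewrite ST setD11 in sS.
rewrite (bigD1 (s |: S)) //= setU11 ffunE setU1K ?eqxx //.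
rewrite big1 ?addr0 /T_step => [|T /eqP TS]; last first.
  case: ifP => // sT; rewrite ffunE; case: eqP => // ST.
  by case: TS; rewrite ST setD1K.
by rewrite /wT /bT setU1K.
Qed.

Lemma flatS S T : T \subset S -> (flat A S <= flat A T)%VS.
Proof.
move=> /subsetP TS; apply/subvP => v /mem_flat[vA vS].
by apply/mem_flat; split=> // s /TS; apply: vS.
Qed.

Lemma relations_onS S T : T \subset S -> (relations_on A T <= relations_on A S)%VS.
Proof.
move=> /subsetP TS; apply/subvP => w /mem_relations_on[wA wT].
apply/mem_relations_on; split=> // r rS; apply: wT.
by apply: contra rS; apply: TS.
Qed.

Lemma flatU1 S s : flat A (s |: S) = (flat A S :&: orthov (inner A) <[nu A s]>)%VS.
Proof.
apply/vspaceP => v; rewrite memv_cap mem_orthov1.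
apply/idP/idP => [/mem_flat[vA vS]|/andP[/mem_flat[vA vS] /eqP vs]].
  rewrite vS ?setU11 // eqxx andbT; apply/mem_flat; split=> // t tS.
  by rewrite vS // setU1r.
by apply/mem_flat; split=> // t; rewrite in_setU1 => /predU1P[->|/vS].
Qed.

Lemma T_step_cell a i j S s t : s \notin S -> t \in T_cell a i j (s |: S) ->
  T_step S s t \in T_cell a (i + 1) j S.
Proof.
move=> sS; move: t; apply: T_cell_sub => p q x y -> -> <- xS yS.
have -> : Posz p + 1 = Posz p.+1 by rewrite -addn1 PoszD.
rewrite /= T_stepE /T_cell cardsU1 sS add1n addnS addSn eqxx; apply: tensv_tens.
  by apply: wedge_extpow (oproj_in _ _ _) xS; apply/flatS/subsetUr.
apply: ext_map_extpow yS; apply/subvP => _ /memv_imgP[w _ ->]; exact: oproj_in.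
Qed.

Hypothesis admA : admissible A.

Lemma nondeg_flat S s : s \notin S -> nondeg (inner A) (flat A S).
Proof.
case: admA => _ ndF _ _ sS; apply: ndF; rewrite properE subsetT.
by apply/subsetPn; exists s.
Qed.

Lemma nondeg_relations_on S : nondeg (@dotr K n) (relations_on A S).
Proof.
case: admA => _ _ ndR ndRS; case: (boolP (S \proper setT)) => [/ndRS //|].
rewrite properT negbK => /eqP ->; rewrite /relations_on big1 ?capvf // => r.
by rewrite inE.
Qed.

(** Up to multiples killed by the outer wedge, both vectors wedged are projections
    to [flat A S], so the wedge factors anticommute; the factors on the relations
    both reduce to the projection to [relations_on A S]. *)
Lemma T_step_anticomm a i j S s t x : s \notin S -> t \notin S -> s != t ->
  x \in T_cell a i j (t |: (s |: S)) ->
  T_step S t (T_step (t |: S) s x) = - T_step S s (T_step (s |: S) t x).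
Proof.
move=> sS tS st; rewrite -[- _]/((-%R \o (T_step S s \o T_step (s |: S) t)) x).
move: x; apply: (@T_cell_eq _ (T_step S t \o T_step (t |: S) s)) => p q x y _ _ /=.
have stS : s \notin t |: S by rewrite in_setU1 negb_or st.
have tsS : t \notin s |: S by rewrite in_setU1 negb_or eq_sym st.
have ndS := nondeg_flat sS.
have bb r : ext_map (oproj (@dotr K n) (relations_on A S))
    (ext_map (oproj (@dotr K n) (relations_on A (r |: S))) y) =
    ext_map (oproj (@dotr K n) (relations_on A S)) y.
  rewrite -ext_map_comp; congr ext_map; apply/lfunP => w; rewrite comp_lfunE.
  by rewrite oproj_oproj ?nondeg_relations_on ?relations_onS ?subsetUr.
rewrite !T_stepE !bb !flatU1 !wedge_oproj_section -?flatU1 //.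
- by rewrite wedgeC -!/(tensl _ _) linearN.
- exact: nondeg_flat tsS.
- exact: nondeg_flat stS.
Qed.

Lemma CT_chain_complex : chain_complex (CT A).
Proof.
have dC a i j x : x \in comp (CT A) a i j ->
    diff (CT A) x \in comp (CT A) a (i + 1) j.
  move=> /mem_T_comp xC; apply/mem_T_comp => S; rewrite T_diffE.
  by apply: memv_suml => s sS; apply: T_step_cell => //; apply: xC.
split=> [a i j|a i j x /mem_T_comp xC].
  by apply/subvP => _ /memv_imgP[x xC ->]; apply: dC.
apply/ffunP => S; rewrite T_diffE [RHS]ffunE.
pose F s t := if [&& s \notin S, t \notin S & s != t] then
  T_step S s (T_step (s |: S) t (x (t |: (s |: S)))) else 0.
rewrite big_mkcond (eq_bigr (fun s => \sum_t F s t)) => [|s _]; last first.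
  case: ifP => sS; last by rewrite big1 // => t _; rewrite /F sS.
  rewrite T_diffE linear_sum big_mkcond; apply: eq_bigr => t _.
  by rewrite /F sS in_setU1 negb_or eq_sym andbC.
apply: sum_antisym => [s|s t]; first by rewrite /F eqxx !andbF.
rewrite /F eq_sym andbCA; case: ifP => [/and3P[sS tS st]|]; last by rewrite oppr0.
rewrite setUCA; apply: T_step_anticomm => //; exact: xC.
Qed.

End TComplexFacts.

(** * Deletion and restriction *)

Lemma dotrC (K : fieldType) n (u v : 'rV[K]_n) : dotr u v = dotr v u.
Proof. exact: form_sym. Qed.

Section RowLift.
Variables (K : fieldType) (n : nat) (l : 'I_n.+1).

(** The coordinate inserted at position [l] is a linear form in the others.  For
    [c = 0] this is the inclusion of a coordinate hyperplane; for a suitable [c]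
    it turns the relations of the restriction into relations of the whole
    arrangement. *)
Definition row_lift_fun (c w : 'rV[K]_n) : 'rV[K]_n.+1 :=
  \row_j if unlift l j is Some k then w 0 k else dotr c w.

Fact row_lift_linear c : linear (row_lift_fun c).
Proof.
move=> a u v; apply/rowP => j; rewrite !mxE; case: unlift => [k|]; rewrite ?mxE //.
by rewrite linearPr.
Qed.
HB.instance Definition _ c := GRing.isLinear.Build K _ _ _ (row_lift_fun c)
  (row_lift_linear c).

(** The adjoint of [row_lift_fun c]; for [c = 0] it forgets the coordinate at
    [l]. *)
Definition row_drop_fun (c : 'rV[K]_n) (w : 'rV[K]_n.+1) : 'rV[K]_n :=
  \row_k (w 0 (lift l k) + w 0 l * c 0 k).

Fact row_drop_linear c : linear (row_drop_fun c).
Proof.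
by move=> a u v; apply/rowP => k; rewrite !mxE mulrDl mulrDr addrACA mulrA.
Qed.
HB.instance Definition _ c := GRing.isLinear.Build K _ _ _ (row_drop_fun c)
  (row_drop_linear c).

Definition row_lift c : 'Hom('rV[K]_n, 'rV[K]_n.+1) := linfun (row_lift_fun c).
Definition row_drop c : 'Hom('rV[K]_n.+1, 'rV[K]_n) := linfun (row_drop_fun c).

Lemma row_lift_lift c w k : row_lift c w 0 (lift l k) = w 0 k.
Proof. by rewrite lfunE mxE liftK. Qed.

Lemma row_lift_l c w : row_lift c w 0 l = dotr c w.
Proof. by rewrite lfunE mxE unlift_none. Qed.

Lemma row_dropE c w k : row_drop c w 0 k = w 0 (lift l k) + w 0 l * c 0 k.
Proof. by rewrite lfunE mxE. Qed.

Lemma row_lift_drop_adj c w u : dotr (row_lift c w) u = dotr w (row_drop c u).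
Proof.
rewrite /dotr (bigD1_ord l) //= row_lift_l.
rewrite (eq_bigr (fun k => w 0 k * u 0 (lift l k))) => [|k _]; last first.
  by rewrite row_lift_lift.
rewrite [RHS](eq_bigr (fun k => u 0 l * (c 0 k * w 0 k) + w 0 k * u 0 (lift l k))).
  by rewrite big_split -mulr_sumr mulrC.
by move=> k _; rewrite row_dropE mulrDr addrC; congr (_ + _); rewrite mulrC mulrA.
Qed.

Lemma row_drop_lift c w : row_drop 0 (row_lift c w) = w.
Proof. by apply/rowP => k; rewrite row_dropE row_lift_lift mxE mulr0 addr0. Qed.

Lemma row_lift_drop c (w : 'rV[K]_n.+1) : w 0 l = dotr c (row_drop 0 w) ->
  row_lift c (row_drop 0 w) = w.
Proof.
move=> wl; apply/rowP => j; case: (unliftP l j) => [k|] ->.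
  by rewrite row_lift_lift row_dropE mxE mulr0 addr0.
by rewrite row_lift_l wl.
Qed.

End RowLift.

Section LiftSet.
Variables (n : nat) (l : 'I_n.+1).
Implicit Types (S : {set 'I_n}) (T : {set 'I_n.+1}).

Lemma notin_lift S : l \notin lift l @: S.
Proof. by apply/imsetP => -[k _] /eqP; rewrite (negPf (neq_lift l k)). Qed.

Lemma mem_lift S k : (lift l k \in lift l @: S) = (k \in S).
Proof. exact/mem_imset/lift_inj. Qed.

Lemma preim_lift S : lift l @^-1: (lift l @: S) = S.
Proof. by apply/setP => k; rewrite inE mem_lift. Qed.

Lemma preim_liftU1 S : lift l @^-1: (l |: lift l @: S) = S.
Proof.
by apply/setP => k; rewrite inE in_setU1 mem_lift eq_sym (negPf (neq_lift l k)).
Qed.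

Lemma lift_preim T : l \notin T -> lift l @: (lift l @^-1: T) = T.
Proof.
move=> lT; apply/setP => j; case: (unliftP l j) => [k|] ->.
  by rewrite mem_lift inE.
by rewrite (negPf lT) (negPf (notin_lift _)).
Qed.

Lemma liftU1_preim T : l \in T -> l |: lift l @: (lift l @^-1: T) = T.
Proof.
move=> lT; apply/setP => j; rewrite in_setU1; case: (unliftP l j) => [k|] ->.
  by rewrite mem_lift inE eq_sym (negPf (neq_lift l k)).
by rewrite eqxx lT.
Qed.

Lemma card_lift S : #|lift l @: S| = #|S|.
Proof. exact/card_imset/lift_inj. Qed.

End LiftSet.

Section TCellMap.
Variables (K : fieldType) (V : vectType K).

Lemma T_cell_mapr n m (A : arrangement V n) (B : arrangement V m)
    (g : 'Hom('rV[K]_n, 'rV[K]_m)) S T (a b i j : int) t :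
  flat A S = flat B T -> (g @: relations_on A S <= relations_on B T)%VS ->
  (forall p : nat, (#|S| + p)%N%:Z = a -> (#|T| + p)%N%:Z = b) ->
  t \in T_cell A a i j S -> tens_mapr (ext_map g) t \in T_cell B b i j T.
Proof.
move=> flatE gS ab; move: t; apply: T_cell_sub => p q x y -> -> /ab Tb xS yS.
rewrite /= tens_mapr_tens /T_cell Tb eqxx; apply: tensv_tens; rewrite -?flatE //.
exact: ext_map_extpow yS.
Qed.

Lemma T_cell_maprK n m (A : arrangement V n) (f : 'Hom('rV[K]_n, 'rV[K]_m))
    (g : 'Hom('rV[K]_m, 'rV[K]_n)) S (a i j : int) :
  {in relations_on A S, cancel f g} ->
  {in T_cell A a i j S, cancel (tens_mapr (ext_map f)) (tens_mapr (ext_map g))}.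
Proof.
move=> fK; apply: (@T_cell_eq _ _ _ _ _ (_ \o _) idfun) => p q x y _ yS /=.
rewrite !tens_mapr_tens /= -ext_map_comp (ext_map_id _ yS) // => w wS.
by rewrite comp_lfunE fK.
Qed.

Lemma T_step_mapr n m (A : arrangement V n) (B : arrangement V m)
    (f g : 'Hom('rV[K]_n, 'rV[K]_m)) S S' T s r (a i j : int) :
  wedge (oproj (inner A) (flat A S) (nu A s)) =1
    wedge (oproj (inner B) (flat B T) (nu B r)) ->
  (forall w, f (oproj (@dotr K n) (relations_on A S) w) =
             oproj (@dotr K m) (relations_on B T) (g w)) ->
  {in T_cell A a i j S', forall t,
    tens_mapr (ext_map f) (T_step A S s t) = T_step B T r (tens_mapr (ext_map g) t)}.
Proof.
move=> wE fg; apply: (@T_cell_eq _ _ _ _ _ (_ \o _) (_ \o _)) => p q x y _ yS /=.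
rewrite T_stepE !tens_mapr_tens T_stepE wE /= -!ext_map_comp.
by congr (tens _ (ext_map _ _)); apply/lfunP => w; rewrite !comp_lfunE.
Qed.

End TCellMap.

Section DeletionRestriction.
Variables (K : fieldType) (V : vectType K) (n : nat).
Variables (A : arrangement V n.+1) (l : 'I_n.+1).
Local Notation D := (deletion A l).
Local Notation R := (restriction A l).
Local Notation dot := (@dotr K _).
Hypothesis (nu_l_neq0 : nu A l != 0).
Hypotheses (admA : admissible A) (admD : admissible D) (admR : admissible R).
Implicit Types (S : {set 'I_n}) (T : {set 'I_n.+1}).

Lemma flat_deletion S : flat D S = flat A (lift l @: S).
Proof.
apply/vspaceP => v; apply/idP/idP => /mem_flat[vA vS]; apply/mem_flat; split=> //.
  by move=> _ /imsetP[k kS ->]; apply: vS.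
by move=> k kS; apply: vS; rewrite mem_lift.
Qed.

Let nd_hyper : nondeg (inner A) (hyper A l).
Proof. by case: admR. Qed.

Lemma inner_hyper v i : v \in hyper A l ->
  inner A v (nu R i) = inner A v (nu A (lift l i)).
Proof. by move=> vH; rewrite form_sym oproj_form // form_sym. Qed.

Lemma flat_restriction S : flat R S = flat A (l |: lift l @: S).
Proof.
apply/vspaceP => v; apply/idP/idP => /mem_flat[vA vS]; apply/mem_flat.
  move: (vA); rewrite mem_hyper => /andP[vsp /eqP vl]; split=> // j.
  rewrite in_setU1 => /predU1P[-> //|/imsetP[k kS ->]].
  by rewrite -inner_hyper // vS.
have vH : v \in hyper A l by rewrite mem_hyper vA vS ?setU11 ?eqxx.
by split=> // k kS; rewrite inner_hyper // vS // setU1r // mem_lift.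
Qed.

(** An isotropic [nu A l] would lie in its own hyperplane and be orthogonal to
    it. *)
Lemma inner_nu_neq0 : inner A (nu A l) (nu A l) != 0.
Proof.
apply: contra nu_l_neq0 => /eqP ll.
apply/eqP; apply: (nondeg_eq0 nd_hyper); first by rewrite mem_hyper nu_in ll eqxx.
by move=> v; rewrite mem_hyper form_sym => /andP[_ /eqP].
Qed.

(** The projection of [nu A (lift l k)] to the hyperplane of [nu A l] is obtained
    by adding this multiple of [nu A l]. *)
Definition res_coef : 'rV[K]_n :=
  \row_k - (inner A (nu A (lift l k)) (nu A l) / inner A (nu A l) (nu A l)).

Lemma nu_restriction k : nu R k = nu A (lift l k) + res_coef 0 k *: nu A l.
Proof.
apply: oproj_eq => // [|w].
  rewrite mem_hyper memvD ?memvZ ?nu_in //= linearDl linearZl_LR /= mxE.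
  by rewrite mulNr divfK ?inner_nu_neq0 // subrr.
rewrite mem_hyper => /andP[_ /eqP wl].
by rewrite linearDl linearZl_LR /= [X in _ * X]form_sym wl mulr0 addr0.
Qed.

Lemma relations_on_restriction S w :
  (w \in relations_on R S) =
  (row_lift l res_coef w \in relations_on A (l |: lift l @: S)).
Proof.
have sumE : \sum_j row_lift l res_coef w 0 j *: nu A j = \sum_k w 0 k *: nu R k.
  rewrite [RHS](eq_bigr _ (fun k _ => congr1 _ (nu_restriction k))).
  rewrite (bigD1_ord l) //= row_lift_l /dotr scaler_suml -big_split.
  apply: eq_bigr => k _; rewrite row_lift_lift scalerDr scalerA.
  by rewrite addrC [_ * w 0 k]mulrC.
apply/idP/idP => /mem_relations_on[w0 wS]; apply/mem_relations_on.
  split=> [|j]; first by rewrite sumE.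
  case: (unliftP l j) => [k|] ->; last by rewrite setU11.
  by rewrite in_setU1 negb_or mem_lift row_lift_lift => /andP[_ /wS].
split=> [|k kS]; first by rewrite -sumE.
rewrite -(row_lift_lift l res_coef) wS // in_setU1 mem_lift negb_or kS.
by rewrite eq_sym neq_lift.
Qed.

(** The coordinate at [l] of a relation is forced by the others: pair the relation
    with [nu A l]. *)
Lemma relation_lift_drop T w : w \in relations_on A T ->
  row_lift l res_coef (row_drop l 0 w) = w.
Proof.
case/mem_relations_on => w0 _; apply: row_lift_drop.
have := congr1 (fun v => inner A v (nu A l)) w0.
rewrite linear0l (bigD1_ord l) //= linearDl linearZl_LR /= linear_sumlz.
move/eqP; rewrite addr_eq0 => /eqP wl.
apply: (mulIf inner_nu_neq0); rewrite wl /dotr mulr_suml -sumrN.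
apply: eq_bigr => k _; rewrite linearZl_LR /= row_dropE !mxE mulr0 addr0.
by rewrite mulrAC mulNr divfK ?inner_nu_neq0 // mulNr mulrC.
Qed.

Lemma row_drop_relations S w : w \in relations_on A (l |: lift l @: S) ->
  row_drop l 0 w \in relations_on R S.
Proof. by move=> wS; rewrite relations_on_restriction (relation_lift_drop wS). Qed.

Lemma relations_on_deletion S w :
  (w \in relations_on D S) = (row_lift l 0 w \in relations_on A (lift l @: S)).
Proof.
have sumE : \sum_j row_lift l 0 w 0 j *: nu A j = \sum_k w 0 k *: nu D k.
  rewrite (bigD1_ord l) //= row_lift_l linear0l scale0r add0r.
  by apply: eq_bigr => k _; rewrite row_lift_lift.
apply/idP/idP => /mem_relations_on[w0 wS]; apply/mem_relations_on.
  split=> [|j]; first by rewrite sumE.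
  case: (unliftP l j) => [k|] ->; first by rewrite mem_lift row_lift_lift; apply: wS.
  by rewrite row_lift_l linear0l.
split=> [|k kS]; first by rewrite -sumE.
by rewrite -(row_lift_lift l 0) wS // mem_lift.
Qed.

Lemma relation_insert_drop S w : w \in relations_on A (lift l @: S) ->
  row_lift l 0 (row_drop l 0 w) = w.
Proof.
case/mem_relations_on => _ wS; apply: row_lift_drop.
by rewrite linear0l wS ?notin_lift.
Qed.

Lemma row_drop_relations_deletion S w : w \in relations_on A (lift l @: S) ->
  row_drop l 0 w \in relations_on D S.
Proof. by move=> wS; rewrite relations_on_deletion (relation_insert_drop wS). Qed.

Let ndA T : nondeg (@dotr K n.+1) (relations_on A T).
Proof. exact: nondeg_relations_on. Qed.
Let ndD S : nondeg (@dotr K n) (relations_on D S).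
Proof. exact: nondeg_relations_on. Qed.
Let ndR S : nondeg (@dotr K n) (relations_on R S).
Proof. exact: nondeg_relations_on. Qed.

Lemma row_insert_oproj S w :
  row_lift l 0 (oproj (@dotr K n) (relations_on D S) w) =
  oproj (@dotr K n.+1) (relations_on A (lift l @: S)) (row_lift l 0 w).
Proof.
apply/esym/oproj_eq => // [|u uS].
  by rewrite -relations_on_deletion oproj_in.
rewrite -(relation_insert_drop uS) /= !row_lift_drop_adj row_drop_lift.
by rewrite oproj_form // row_drop_relations_deletion.
Qed.

(** Forgetting the coordinate at [l] identifies the relations on [l |: S] with
    those of the restriction on [S], but it is not an isometry and need not
    commute with the orthogonal projections.  The adjoint of its inverse does:
    orthogonal projections are adjoint to inclusions, with which the
    identification is compatible.  That adjoint is [res_map S]. *)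
Definition res_map S : 'Hom('rV[K]_n.+1, 'rV[K]_n) :=
  (oproj (@dotr K n) (relations_on R S) \o row_drop l res_coef)%VF.

(** The adjoint of forgetting the coordinate at [l], inverse to [res_map S]. *)
Definition res_inv S : 'Hom('rV[K]_n, 'rV[K]_n.+1) :=
  (oproj (@dotr K n.+1) (relations_on A (l |: lift l @: S)) \o row_lift l 0)%VF.

Lemma res_map_form S w u : u \in relations_on R S ->
  dotr (res_map S w) u = dotr w (row_lift l res_coef u).
Proof.
by move=> uS; rewrite comp_lfunE oproj_form //= dotrC -row_lift_drop_adj dotrC.
Qed.

Lemma res_inv_form S w u : u \in relations_on A (l |: lift l @: S) ->
  dotr (res_inv S w) u = dotr w (row_drop l 0 u).
Proof. by move=> uS; rewrite comp_lfunE oproj_form //= row_lift_drop_adj. Qed.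

Lemma res_map_in S w : res_map S w \in relations_on R S.
Proof. by rewrite comp_lfunE oproj_in. Qed.

Lemma res_inv_in S w : res_inv S w \in relations_on A (l |: lift l @: S).
Proof. by rewrite comp_lfunE oproj_in. Qed.

Lemma res_mapK S : {in relations_on A (l |: lift l @: S), cancel (res_map S) (res_inv S)}.
Proof.
move=> w wS; apply: (nondeg_eq (ndA _) (res_inv_in _ _) wS) => u uS /=.
rewrite res_inv_form // res_map_form ?row_drop_relations //.
by rewrite (relation_lift_drop uS).
Qed.

Lemma res_invK S : {in relations_on R S, cancel (res_inv S) (res_map S)}.
Proof.
move=> w wS; apply: (nondeg_eq (ndR _) (res_map_in _ _) wS) => u uS /=.
rewrite res_map_form // res_inv_form -?relations_on_restriction //.
by rewrite row_drop_lift.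
Qed.

(** Paired with a relation [u] of the restriction on [S], both sides give the
    product of [w] with the lift of [u]. *)
Lemma res_map_oproj S S' w : S \subset S' ->
  res_map S (oproj (@dotr K n.+1) (relations_on A (l |: lift l @: S)) w) =
  oproj (@dotr K n) (relations_on R S) (res_map S' w).
Proof.
move=> SS'; apply/esym/oproj_eq; rewrite ?res_map_in // => u uS /=.
rewrite res_map_form ?(subvP (relations_onS _ SS')) // res_map_form //.
by rewrite oproj_form // -relations_on_restriction.
Qed.

Definition del_incl (x : CT D) : CT A :=
  [ffun T : {set 'I_n.+1} => if l \in T then 0
             else tens_mapr (ext_map (row_lift l 0)) (x (lift l @^-1: T))].

Fact del_incl_linear : linear del_incl.
Proof.
move=> a x y; apply/ffunP => T; rewrite !ffunE.
by case: ifP => _; rewrite ?scaler0 ?addr0 // linearP.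
Qed.
HB.instance Definition _ := GRing.isLinear.Build K _ _ _ del_incl del_incl_linear.

Definition res_proj (x : CT A) : CT R :=
  [ffun S : {set 'I_n} => tens_mapr (ext_map (res_map S)) (x (l |: lift l @: S))].

Fact res_proj_linear : linear res_proj.
Proof. by move=> a x y; apply/ffunP => S; rewrite !ffunE linearP. Qed.
HB.instance Definition _ := GRing.isLinear.Build K _ _ _ res_proj res_proj_linear.

Lemma del_incl_lift x S :
  del_incl x (lift l @: S) = tens_mapr (ext_map (row_lift l 0)) (x S).
Proof. by rewrite ffunE (negPf (notin_lift l S)) preim_lift. Qed.

Lemma del_incl_l x T : l \in T -> del_incl x T = 0.
Proof. by move=> lT; rewrite ffunE lT. Qed.

Lemma del_inclK a i j x : x \in comp (CT D) a i j ->
  forall S, tens_mapr (ext_map (row_drop l 0)) (del_incl x (lift l @: S)) = x S.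
Proof.
move=> /mem_T_comp xC S; rewrite del_incl_lift.
by apply: (T_cell_maprK _ (xC S)) => w _; apply: row_drop_lift.
Qed.

Lemma del_incl_diff a i j x : x \in comp (CT D) a i j ->
  del_incl (diff (CT D) x) = diff (CT A) (del_incl x).
Proof.
move=> /mem_T_comp xC; apply/ffunP => T; rewrite [RHS]T_diffE.
case: (boolP (l \in T)) => lT.
  rewrite del_incl_l // big1 // => s _.
  by rewrite del_incl_l ?linear0 // in_setU1 lT orbT.
rewrite -(lift_preim lT) del_incl_lift; set S := _ @^-1: _.
rewrite T_diffE [RHS]big_mkcond (bigD1_ord l) //= notin_lift.
rewrite del_incl_l ?setU11 // linear0 add0r -big_mkcond /= linear_sum.
apply: eq_big => [k|k kS]; first by rewrite mem_lift.
rewrite -imsetU1 del_incl_lift; apply: (T_step_mapr _ _ (xC _)) => [y|w].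
  by rewrite flat_deletion.
exact: row_insert_oproj.
Qed.

Lemma res_proj_diff a i j x : x \in comp (CT A) a i j ->
  res_proj (diff (CT A) x) = diff (CT R) (res_proj x).
Proof.
move=> /mem_T_comp xC; apply/ffunP => S; rewrite [RHS]T_diffE ffunE T_diffE.
rewrite big_mkcond (bigD1_ord l) //= setU11 add0r -big_mkcond /= linear_sum.
have memT k : (lift l k \in l |: lift l @: S) = (k \in S).
  by rewrite in_setU1 mem_lift eq_sym (negPf (neq_lift l k)).
apply: eq_big => [k|k]; rewrite memT // => kS.
rewrite [in RHS]ffunE imsetU1 setUCA.
apply: (T_step_mapr _ _ (xC _)) => [y|w].
  have ndT : nondeg (inner A) (flat A (l |: lift l @: S)).
    by apply: (nondeg_flat admA (s := lift l k)); rewrite memT.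
  rewrite flat_restriction [oproj _ _ (nu R k)]oproj_oproj //.
  apply/subvP => v /mem_flat[vA vT].
  by rewrite mem_hyper vA vT ?setU11 ?eqxx.
by apply: res_map_oproj; apply: subsetUr.
Qed.

Lemma del_incl_comp a i j x :
  x \in comp (CT D) a i j -> del_incl x \in comp (CT A) a i j.
Proof.
move=> /mem_T_comp xC; apply/mem_T_comp => T.
case: (boolP (l \in T)) => lT; first by rewrite del_incl_l ?mem0v.
rewrite -(lift_preim lT) del_incl_lift; set S := _ @^-1: _.
apply: T_cell_mapr (xC S); rewrite ?flat_deletion ?card_lift //.
by apply/subvP => _ /memv_imgP[w wS ->]; rewrite -relations_on_deletion.
Qed.

Lemma res_proj_comp a i j x :
  x \in comp (CT A) a i j -> res_proj x \in comp (shift (CT R)) a i j.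
Proof.
move=> /mem_T_comp xC; apply/mem_T_comp => S; rewrite ffunE.
apply: T_cell_mapr (xC _); rewrite ?flat_restriction //.
  by apply/subvP => _ /memv_imgP[w _ ->]; apply: res_map_in.
move=> p <-; rewrite cardsU1 notin_lift card_lift.
by rewrite add1n addSn intS addrC addKr.
Qed.

Lemma res_proj_del_incl x : res_proj (del_incl x) = 0.
Proof.
by apply/ffunP => S; rewrite !ffunE setU11 linear0.
Qed.

(** On the summands containing [l] the maps [res_map S] are injective, so an
    element of the kernel lives on the other ones, where [row_lift l 0] is onto
    the relations. *)
Lemma del_incl_ker a i j y : y \in comp (CT A) a i j -> res_proj y = 0 ->
  exists2 x, x \in comp (CT D) a i j & y = del_incl x.
Proof.
move=> /mem_T_comp yC y0.
pose x : CT D := [ffun S : {set 'I_n} =>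
  tens_mapr (ext_map (row_drop l 0)) (y (lift l @: S))].
exists x.
  apply/mem_T_comp => S; rewrite ffunE.
  apply: T_cell_mapr (yC _); rewrite ?flat_deletion ?card_lift //.
  apply/subvP => _ /memv_imgP[w wS ->]; exact: row_drop_relations_deletion.
apply/ffunP => T; case: (boolP (l \in T)) => lT.
  rewrite del_incl_l // -(liftU1_preim lT); set S := _ @^-1: _.
  rewrite -(T_cell_maprK (@res_mapK S) (yC _)).
  by have /ffunP/(_ S) := y0; rewrite !ffunE => ->; rewrite linear0.
rewrite -(lift_preim lT) del_incl_lift ffunE.
apply/esym/(T_cell_maprK _ (yC _)) => w wS; exact: relation_insert_drop wS.
Qed.

Lemma res_proj_onto a i j z : z \in comp (shift (CT R)) a i j ->
  exists2 y, y \in comp (CT A) a i j & z = res_proj y.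
Proof.
move=> /mem_T_comp zC.
pose y : CT A := [ffun T : {set 'I_n.+1} => if l \in T then
  tens_mapr (ext_map (res_inv (lift l @^-1: T))) (z (lift l @^-1: T)) else 0].
exists y.
  apply/mem_T_comp => T; rewrite ffunE; case: ifP => [lT|_]; last exact: mem0v.
  move: (lift l @^-1: T) (liftU1_preim lT) => S <-.
  apply: T_cell_mapr (zC S); rewrite ?flat_restriction //.
    by apply/subvP => _ /memv_imgP[w _ ->]; apply: res_inv_in.
  move=> p Sp; rewrite cardsU1 notin_lift card_lift.
  by rewrite add1n addSn intS Sp addrC subrK.
apply/ffunP => S; rewrite !ffunE setU11 preim_liftU1.
exact/esym/(T_cell_maprK (@res_invK S) (zC S)).
Qed.

End DeletionRestriction.

Theorem theorem2p12 (K : fieldType) (charK : [pchar K] =i pred0)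
    (V : vectType K) (n : nat) (A : arrangement V n.+1) (l : 'I_n.+1)
    (nu_l_neq0 : nu A l != 0)
    (admA : admissible A) (admD : admissible (deletion A l))
    (admR : admissible (restriction A l)) :
  exists (iota : 'Hom(CT (deletion A l), CT A))
         (pi : 'Hom(CT A, shift (CT (restriction A l)))),
    ses_of_complexes iota pi /\
    exists delta : forall a i j : int,
        'Hom(homology (shift (CT (restriction A l))) a i j,
             homology (CT (deletion A l)) a (i + 1) j),
      connecting iota pi delta /\ long_exact iota pi delta.
Proof.
pose iota : 'Hom(CT (deletion A l), CT A) := linfun (@del_incl K V n A l).
pose pi : 'Hom(CT A, shift (CT (restriction A l))) :=
  linfun (@res_proj K V n A l).
have iotaE x : iota x = del_incl x by rewrite lfunE.
have piE x : pi x = res_proj l x by rewrite lfunE.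
have ses : ses_of_complexes iota pi.
  split.
  - have [dR ddR] := CT_chain_complex admR.
    split; first exact: CT_chain_complex.
    split; first exact: CT_chain_complex.
    by split=> [a i j|a i j x xR]; [apply: dR | apply: ddR xR].
  - split=> [a i j|a i j x xC]; last by rewrite !iotaE; apply: del_incl_diff xC.
    by apply/subvP => _ /memv_imgP[x xC ->]; rewrite iotaE; apply: del_incl_comp.
  - split=> [a i j|a i j x xC]; last by rewrite !piE; apply: res_proj_diff xC.
    by apply/subvP => _ /memv_imgP[x xC ->]; rewrite piE; apply: res_proj_comp.
  - move=> a i j; split.
    + apply/eqP; rewrite -subv0; apply/subvP => x; rewrite memv_cap memv_ker iotaE.
      case/andP => xC /eqP x0; rewrite memv0; apply/eqP/ffunP => S.
      by rewrite -(del_inclK xC) x0 [RHS]ffunE ffunE linear0.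
    + apply/vspaceP => y; rewrite memv_cap memv_ker piE.
      apply/memv_imgP/andP => [[x xC ->]|[yC /eqP y0]].
        by rewrite iotaE del_incl_comp // res_proj_del_incl.
      have [x xC ->] := del_incl_ker nu_l_neq0 admA admR yC y0.
      by exists x; rewrite ?iotaE.
    + apply/vspaceP => z; apply/memv_imgP/idP => [[y yC ->]|zC].
        by rewrite piE; apply: res_proj_comp.
      have [y yC ->] := res_proj_onto nu_l_neq0 admA admR zC.
      by exists y; rewrite ?piE.
exists iota, pi; split=> //; exists (snake_map iota pi).
by split; [apply: snake_mapP | apply: snake_long_exact].
Qed.
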